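(* Let $M$ be an $n$-dimensional $C^1$ manifold equipped with its Borel $\sigma$-algebra, and let $\Phi^t:M\to M$ $(t\in\mathbb{R})$ be a $C^1$ flow generated by a vector field $V$, with an ergodic invariant probability measure $\mu$ whose support $X\subset M$ is compact. Let $z:X\to S^1$ be a non-constant $C(X)$ or $L^2(\mu)$ Koopman eigenfunction with eigenfrequency $\omega$. Let $\mathcal F_\theta=z^{-1}(e^{\iota\theta})$, $\mathcal L_1=\mathcal F_0=z^{-1}(1)$, let $\nu=\mu|\mathcal L_1$ be the conditional measure of $\mu$ on $\mathcal L_1$ obtained by disintegration with respect to the partition $\{\mathcal F_\theta\}$, let $R=\Phi^{2\pi/\omega}:\mathcal L_1\to\mathcal L_1$, let $\Gamma^t$ be the suspension flow with base $\mathcal L_1$, return map $R$ and height $1$, and let $\Psi:\mathcal L_1\times[0,1)\to X$, $\Psi(y,t)=\Phi^{t\cdot 2\pi/\omega}y$. Then: (i) $\Psi$ is a measure preserving, continuous conjugacy between the suspension flow $\Gamma^t$ and the flow $\Phi^{2\pi t/\omega}$: $\Psi\circ\Gamma^t=\Phi^{2\pi t/\omega}\circ\Psi$ for all $t\in\mathbb{R}$. (ii) Let $\zeta$ be an $L^2(\mu)$ (or $C(X)$) eigenfunction of $V$ with eigenfrequency $\omega'$, i.e. $V\zeta=\iota\omega'\zeta$. Then the map $\tilde\zeta:\mathcal L_1\to\mathbb{C}$, $\tilde\zeta(x)=\zeta(\Psi(x,0))$, is an $L^2(\nu)$ (or $C(\mathcal L_1)$) eigenfunction of the return map $R$ with eigenvalue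 $e^{\iota 2\pi\omega'/\omega}$. (iii) Conversely, for any $L^2(\nu)$ (or $C(\mathcal L_1)$) eigenfunction $\tilde\zeta$ of $R$ with eigenvalue $e^{\iota 2\pi\omega'/\omega}$, the map $\zeta:X\to\mathbb{C}$ given by $\zeta(\Psi(y,s))=e^{\iota 2\pi\omega's/\omega}\,\tilde\zeta(y)$, $y\in\mathcal L_1$, $s\in[0,1)$, is an $L^2(\mu)$ (or $C(X)$) eigenfunction of $V$ with eigenfrequency $\omega'$.
   Context: $S^1$ is the unit circle in $\mathbb{C}$ and $\iota=\sqrt{-1}$. A $C(X)$ (resp. $L^2(\mu)$) Koopman eigenfunction with eigenfrequency $\omega\in\mathbb{R}$ is a function $z$ in that space with $z(\Phi^tx)=e^{\iota\omega t}z(x)$ for all $t\in\mathbb{R}$ and all $x\in X$ (resp. $\mu$-a.e. $x$); equivalently $Vz=\iota\omega z$, where $V$ is the generator of the Koopman group $U^tf=f\circ\Phi^t$. An eigenfunction of $R$ with eigenvalue $\lambda$ is a function $f$ on $\mathcal L_1$ with $f\circ R=\lambda f$ (everywhere, or $\nu$-a.e. in the $L^2$ case). Conditional measures $\mu|\mathcal F_\theta$ are probability measures supported on $\mathcal F_\theta$ with $\int\phi\,d\mu=\int_{S^1}\int_{\mathcal F_\theta}\phi\,d(\mu|\mathcal F_\theta)\,d\mathrm{Leb}(\theta)$ for $\phi\in C(M)$, with $\mathrm{Leb}$ the Lebesgue probability measure on the circle. The suspension flow with base $\mathcal L_1$, return map $R$ and height $1$ acts on $\mathcal L_1\times\mathbb{R}/\!\sim$,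 where $\sim$ is generated by $(x,s+1)\sim(R(x),s)$ (represented by $\mathcal L_1\times[0,1)$), by $\Gamma^t(x,s)=(R^N(x),s+t-N)$, where $N\in\mathbb{Z}$ is such that $0\le s+t-N<1$; its invariant measure is $\nu\times\mathrm{Leb}$. When $z$ is only an $L^2(\mu)$ eigenfunction, statements hold up to sets of measure zero.
   Formalization: Conditional measures are taken weakly continuous in θ (else ν is undetermined); L² functions enter through versions satisfying the equation for all t off one null set; the C(X) form of (iii) is dropped if z is only L²(μ), since ζ̃=1, ω'=ω then gives ζ=z. *)

(* Defs.v *)
From HB Require Import structures.
From mathcomp Require Import all_boot all_order all_algebra.
From mathcomp Require Import complex.
From mathcomp Require Import all_classical all_reals all_analysis.

Set Implicit Arguments.
Unset Strict Implicit.
Unset Printing Implicit Defensive.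

Import Order.TTheory GRing.Theory Num.Theory.
Import numFieldTopology.Exports numFieldNormedType.Exports.

Local Open Scope classical_set_scope.
Local Open Scope ring_scope.

Notation Borel M := (g_sigma_algebraType (@open M)).

(* The regular module R[i]^o carries the topology of the norm of R[i]. *)
Notation Cx R := (R[i]^o).

Section C1_manifolds.
Context {R : realType}.

(* On finite-dimensional spaces, continuity of every x |-> 'd f x v is
   continuity of x |-> 'd f x in the operator norm. *)
Definition C1_on (U W : normedModType R) (D : set U) (f : U -> W) : Prop :=
  forall x, D x -> differentiable f x /\
    forall v, {for x, continuous (fun y => 'd f y v : W)}.

Record C1_atlas (n : nat) (M : topologicalType) := C1Atlas {
  chart_idx : Type;
  chart_dom : chart_idx -> set M;
  chart : chart_idx -> M -> 'rV[R]_n;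
  chart_inv : chart_idx -> 'rV[R]_n -> M;
  chart_dom_open : forall i, open (chart_dom i);
  chart_cover : forall x, exists i, chart_dom i x;
  chart_img_open : forall i, open (chart i @` chart_dom i);
  chartK : forall i x, chart_dom i x -> chart_inv i (chart i x) = x;
  chart_cont : forall i, {within chart_dom i, continuous (chart i)};
  chart_inv_cont :
    forall i, {within chart i @` chart_dom i, continuous (chart_inv i)};
  chart_transition : forall i j,
    C1_on (chart i @` (chart_dom i `&` chart_dom j))
          (chart j \o chart_inv i)
}.

Context {n : nat} {M : topologicalType} (A : C1_atlas n M).

Definition C1_flow (Phi : R -> M -> M) : Prop :=
  [/\ forall x, Phi 0 x = x,
      forall s t x, Phi (s + t) x = Phi s (Phi t x),
      continuous (fun p : R * M => Phi p.1 p.2) &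
      forall i j : chart_idx A,
        C1_on [set p : R * 'rV[R]_n |
                 (chart i @` chart_dom i) p.2 /\
                 chart_dom j (Phi p.1 (chart_inv i p.2))]
              (fun p : R * 'rV[R]_n => chart j (Phi p.1 (chart_inv i p.2)))].

(* V i x holds the components of the tangent vector at x in the chart i; the
   condition is the transformation law under change of charts. *)
Definition vector_field (V : chart_idx A -> M -> 'rV[R]_n) : Prop :=
  forall i j x, chart_dom i x -> chart_dom j x ->
    V j x = 'd (chart j \o chart_inv i) (chart i x) (V i x).

Definition generates (V : chart_idx A -> M -> 'rV[R]_n) (Phi : R -> M -> M)
    : Prop :=
  forall i x (t : R), chart_dom i (Phi t x) ->
    is_derive t (1 : R) (fun s : R => chart i (Phi s x)) (V i (Phi t x)).

End C1_manifolds.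

Section invariant_measures.
Context {R : realType} {M : ptopologicalType}.
Variables (mu : probability (Borel M) R) (Phi : R -> M -> M).

Definition flow_invariant : Prop :=
  forall t (B : set (Borel M)), measurable B -> mu (Phi t @^-1` B) = mu B.

Definition flow_ergodic : Prop :=
  forall B : set (Borel M), measurable B -> (forall t, Phi t @^-1` B = B) ->
    mu B = 0%E \/ mu B = 1%E.

Definition msupport : set M :=
  [set x | forall U : set M, open U -> U x -> (0 < mu U)%E].

End invariant_measures.

Section eigenfunctions.
Context {R : realType} {M : ptopologicalType}.
Implicit Types (mu : probability (Borel M) R) (z : M -> Cx R).

(* e^(i theta) *)
Definition cis (theta : R) : Cx R := (cos theta +i* sin theta)%C.

Definition cmeasurable z : Prop :=
  measurable_fun setT (fun x : Borel M => complex.Re (z x)) /\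
  measurable_fun setT (fun x : Borel M => complex.Im (z x)).

(* z is a representative of a class in L^2(mu); mu may be carried by a proper
   subset of M, off which the values of z are irrelevant. *)
Definition in_L2 mu z : Prop :=
  exists g : M -> Cx R,
    [/\ cmeasurable g, {ae mu, forall x, z x = g x} &
        (\int[mu]_x ((complex.Re (g x) ^+ 2 + complex.Im (g x) ^+ 2)%:E)
           < +oo)%E].

Definition koopman_eigen_C (X : set M) (Phi : R -> M -> M) (omega : R) z
    : Prop :=
  {within X, continuous z} /\
  forall t x, X x -> z (Phi t x) = cis (omega * t) * z x.

Definition koopman_eigen_L2 mu (Phi : R -> M -> M) (omega : R) z : Prop :=
  in_L2 mu z /\
  forall t, {ae mu, forall x, z (Phi t x) = cis (omega * t) * z x}.

(* z1 is a Borel representative of z for which the eigenfunction equation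
   holds, off a single mu-null set, for all times at once. Fibres of z and
   restrictions of z to a fibre, which is mu-null, have a meaning only for such
   representatives. *)
Definition orbitwise_version mu (Phi : R -> M -> M) (omega : R) z z1 : Prop :=
  [/\ cmeasurable z1, {ae mu, forall x, z1 x = z x} &
      {ae mu, forall x, forall t, z1 (Phi t x) = cis (omega * t) * z1 x}].

Definition map_eigen_C (L : set M) (f : M -> M) (lambda : Cx R) z : Prop :=
  {within L, continuous z} /\ forall x, L x -> z (f x) = lambda * z x.

Definition map_eigen_L2 mu (f : M -> M) (lambda : Cx R) z : Prop :=
  in_L2 mu z /\ {ae mu, forall x, z (f x) = lambda * z x}.

Definition vanishes_on (L : set M) z : Prop := forall x, L x -> z x = 0.

Definition vanishes_ae mu z : Prop := {ae mu, forall x, z x = 0}.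

End eigenfunctions.

Section disintegration.
Context {R : realType} {M : ptopologicalType}.

Definition fiber (X : set M) (z : M -> Cx R) (theta : R) : set M :=
  X `&` [set x | z x = cis theta].

(* kappa theta is mu | F_theta. The disintegration formula determines kappa
   only for almost every theta, hence says nothing about the single fibre
   theta = 0; the last condition (weak continuity in theta) singles out one
   version of the disintegration. *)
Definition conditional_measures (mu : probability (Borel M) R) (X : set M)
    (z : M -> Cx R) (kappa : R -> probability (Borel M) R) : Prop :=
  [/\ forall theta, kappa theta (fiber X z theta) = 1%E,
      forall theta (B : set (Borel M)), measurable B ->
        kappa (theta + 2 * pi) B = kappa theta B,
      forall phi : M -> R, continuous phi ->
        \int[mu]_x phi x =
        (2 * pi)^-1 *
          \int[lebesgue_measure]_(theta in `[0, 2 * pi])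
             (\int[kappa theta]_x phi x) &
      forall phi : M -> R, continuous phi ->
        continuous (fun theta : R => \int[kappa theta]_x phi x)].

End disintegration.

Section suspension.
Context {R : realType} {M : topologicalType}.
Implicit Types (f g : M -> M) (Y : set M).

(* f^k for k : int, where g is the inverse of f *)
Definition iterz f g (k : int) (x : M) : M :=
  match k with Posz m => iter m f x | Negz m => iter m.+1 g x end.

(* representative in M * [0, 1) of the class of (x, s) under
   (x, s + 1) ~ (f x, s) *)
Definition suspension_proj f g (p : M * R) : M * R :=
  (iterz f g (Num.floor p.2) p.1, p.2 - (Num.floor p.2)%:~R).

Definition suspension_flow f g (t : R) (p : M * R) : M * R :=
  suspension_proj f g (p.1, p.2 + t).

Definition suspension_space Y : set (M * R) := Y `*` [set` `[0 : R, 1[].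

(* quotient topology of (Y * R)/~, transported to Y * [0, 1) *)
Definition suspension_open f g Y (O : set (M * R)) : Prop :=
  O `<=` suspension_space Y /\
  exists W : set (M * R), open W /\
    forall p, Y p.1 -> (O (suspension_proj f g p) <-> W p).

Definition suspension_continuous f g Y (h : M * R -> M) : Prop :=
  forall U : set M, open U ->
    suspension_open f g Y (suspension_space Y `&` h @^-1` U).

Definition suspension_open_map f g Y (X : set M) (h : M * R -> M) : Prop :=
  forall O, suspension_open f g Y O ->
    exists U : set M, open U /\ h @` O = X `&` U.

End suspension.

(* Main.v *)
Require Import Defs.
From HB Require Import structures.
From mathcomp Require Import all_boot all_order all_algebra.
From mathcomp Require Import complex.
From mathcomp Require Import all_classical all_reals all_analysis.
From mathcomp Require Import measurable_realfun giry uniform_distribution.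
From mathcomp Require Import ring lra zify.

Set Implicit Arguments.
Unset Strict Implicit.
Unset Printing Implicit Defensive.

Import Order.TTheory GRing.Theory Num.Theory.
Import numFieldTopology.Exports numFieldNormedType.Exports.

Local Open Scope classical_set_scope.
Local Open Scope ring_scope.

(** Put [T = 2 pi / omega] and write [z = e^(2 pi i beta)] with the phase [beta]
    in [0, 1).  As [z (Phi^(u T) x) = e^(2 pi i u) z x], the phase grows at unit
    speed modulo 1 when orbits are run with time unit [T].  So each [x] is
    [Psi (y, s)] for exactly one [y] in the fibre [L1] of phase 0 and one [s] in
    [0, 1): [s = beta x] and [y = p x], where [p x = Phi^(- beta x T) x].  The
    conjugacy relation is the group law of the flow, and the identification of
    [(y, s + 1)] with [(R y, s)] is the equality [Phi^(s T) (Phi^T y) =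
    Phi^((s + 1) T) y].  Division by [omega] is legitimate: an eigenfunction of
    frequency 0 is invariant, hence constant by ergodicity ([eigenfrequency0]).

    Measures.  Let [nu] be the image of [mu] under [p].  Fubini, the invariance
    of [mu] and the translation invariance of Lebesgue measure show that [mu] is
    the average over [s] in [0, 1) of the images of [nu] under [Phi^(s T)]
    ([section_disintegration]); in other words [Psi] carries the product of [nu]
    and Lebesgue measure to [mu].  Hence the images of [nu] under
    [Phi^(theta / omega)] are conditional measures ([phase_conditional]).  For
    any other family [kappa], the disintegration formula extends from continuous
    to Borel functions, so that it can be localised to the phases below [b]; it
    then gives the mean of [kappa theta] over [0 <= theta < 2 pi b] for every
    small [b], and weak continuity at 0 gives [kappa 0 = nu]
    ([conditional_unique]).

    Null sets.  When [z] is only square integrable, each relation holds off a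
    null set that depends on the time.  Averaging [e^(- i omega t) z (Phi^t x)]
    over [0 <= t <= 1] yields a Borel representative for which it holds at all
    times off a single null set ([orbitwise_version_exists]).  The set of good
    points is invariant but perhaps not Borel; the points whose orbits lie, at
    almost all times, in a Borel part of full measure form an invariant Borel
    subset of full measure ([invariant_borel_core]).  All arguments take place
    in that subset, and in the whole support when [z] is continuous.

    Eigenfunctions.  On the orbit of [y] in [L1], an eigenfunction of frequency
    [omega'] is [zeta (Psi (y, s)) = e^(i omega' s T) zeta y].  The values of such
    a function on [L1] satisfy the eigenvalue equation of [R], and conversely
    that equation is what makes the formula consistent from one period to the
    next ([eigen_extension]).  Vanishing and square integrability pass between
    [mu] and [nu] because [nu] is an image of [mu] and the factor has modulus 1.

    Topology.  If [z] is continuous then [L1] is compact, and so is the product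
    of [L1] and [0, 1]; [Psi] is therefore a closed map on it.  This replaces
    the continuity of the inverse of [Psi]: it shows that [Psi] is open for the
    quotient topology ([suspension_open_flow]) and that extended eigenfunctions
    are continuous ([extension_continuous]). *)


(** * The circle *)

Section circle.
Context {R : realType}.
Implicit Types (w : Cx R) (a b s : R).

Lemma cisD a b : cis (a + b) = cis a * cis b :> Cx R.
Proof.
rewrite /cis cosD sinD; apply/eqP; rewrite eq_complex /=.
by apply/andP; split; apply/eqP; ring.
Qed.

Lemma cis0 : cis 0 = 1 :> Cx R.
Proof. by rewrite /cis cos0 sin0. Qed.

Lemma normc_cis a : complex.Re (cis a) ^+ 2 + complex.Im (cis a) ^+ 2 = 1.
Proof. exact: cos2Dsin2. Qed.

Lemma norm1P w :
  `|w| = 1 <-> complex.Re w ^+ 2 + complex.Im w ^+ 2 = 1.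
Proof.
split=> [w1|w1].
  have := add_Re2_Im2 (w : R[i]); rewrite [`|_|]w1 expr1n => /eqP.
  by rewrite eq_complex /= => /andP[/eqP].
by have := normc_def (w : R[i]); rewrite w1 sqrtr1.
Qed.

Lemma norm_cis a : `|cis a| = 1 :> Cx R.
Proof. by apply/norm1P; exact: normc_cis. Qed.

Lemma cis_neq0 a : cis a != 0 :> Cx R.
Proof. by rewrite -normr_gt0 norm_cis ltr01. Qed.

Lemma cisN a : cis (- a) = (cis a)^-1 :> Cx R.
Proof.
apply: (mulfI (cis_neq0 a)); rewrite -cisD subrr cis0 mulfV//.
exact: cis_neq0.
Qed.

Lemma cis_2pi : cis (2 * pi) = 1 :> Cx R.
Proof.
by rewrite /cis mulr_natl cos2pi -[pi *+ 2]add0r sinD2pi sin0.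
Qed.

Lemma cis_2pi_nat (n : nat) : cis (2 * pi * n%:R) = 1 :> Cx R.
Proof.
elim: n => [|n IH]; first by rewrite mulr0 cis0.
have -> : 2 * pi * n.+1%:R = 2 * pi * n%:R + 2 * pi :> R.
  by rewrite -[n.+1]addn1 natrD; ring.
by rewrite cisD IH cis_2pi mulr1.
Qed.

Lemma cis_2pi_int (k : int) : cis (2 * pi * k%:~R) = 1 :> Cx R.
Proof.
case: k => n; first exact: cis_2pi_nat.
by rewrite NegzE mulrNz mulrN cisN cis_2pi_nat invr1.
Qed.

Lemma cis_2pi_eq1 s : 0 <= s < 1 -> cis (2 * pi * s) = 1 :> Cx R -> s = 0.
Proof.
move=> /andP[s0 s1] /(congr1 (@complex.Re R)) /= cos1.
have [//|sneq0] := eqVneq s 0.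
have spi : 0 < pi * s < pi.
  have sgt0 : 0 < s by rewrite lt_neqAle eq_sym sneq0.
  by rewrite mulr_gt0 ?pi_gt0//= gtr_pMr ?pi_gt0.
have := sin_gt0_pi spi.
have : cos (2 * pi * s) = 1 - 2 * sin (pi * s) ^+ 2.
  have -> : 2 * pi * s = pi * s *+ 2 by ring.
  by rewrite cos_mulr2n; have := cos2Dsin2 (pi * s); lra.
rewrite cos1; nra.
Qed.

Lemma cis_2pi_inj s t : 0 <= s < 1 -> 0 <= t < 1 ->
  cis (2 * pi * s) = cis (2 * pi * t) :> Cx R -> s = t.
Proof.
wlog st : s t / t <= s.
  move=> H s01 t01 e; have [ts|/ltW st] := leP t s; first exact: H.
  by apply/esym/H.
move=> /andP[s0 s1] /andP[t0 t1] e; apply/eqP; rewrite -subr_eq0; apply/eqP.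
apply: cis_2pi_eq1; first by apply/andP; split; lra.
by rewrite mulrBr cisD e cisN mulfV// cis_neq0.
Qed.

Lemma cis_2pi_int_diff s t : cis (2 * pi * s) = cis (2 * pi * t) :> Cx R ->
  exists k : int, s = t + k%:~R.
Proof.
move=> e; exists (Num.floor (s - t)).
have : s - t - (Num.floor (s - t))%:~R = 0.
  apply: cis_2pi_eq1.
    have /andP[h1 h2] := real_floor_itv (num_real (s - t)).
    by move: h2; rewrite intrD => h2; apply/andP; split; lra.
  rewrite mulrBr cisD cisN cis_2pi_int invr1 mulr1 mulrBr cisD e cisN mulfV//.
  exact: cis_neq0.
lra.
Qed.

(** The argument of [w] divided by [2 pi], for [w] of modulus 1.  Cutting [acos] off
    outside [-1, 1] keeps the function Borel, and in [0, 1), on the whole plane. *)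
Definition phase w : R :=
  let r := if complex.Re w <= -1 then pi
           else if 1 <= complex.Re w then 0 else acos (complex.Re w) in
  if 0 <= complex.Im w then r / (2 * pi)
  else if r == 0 then 0 else 1 - r / (2 * pi).

Lemma phase_itv w : 0 <= phase w < 1.
Proof.
rewrite /phase /=; set r := if complex.Re w <= -1 then _ else _.
have pi0 : 0 < 2 * pi :> R by rewrite mulr_gt0 ?pi_gt0.
have /andP[r0 rpi] : 0 <= r <= pi.
  rewrite /r; case: ifPn => [_|]; first by rewrite pi_ge0 lexx.
  rewrite -ltNge => r1; case: ifPn => [_|]; first by rewrite pi_ge0 lexx.
  rewrite -ltNge => r2.
  have rr : -1 <= complex.Re w <= 1 by rewrite !ltW.
  by rewrite acos_ge0//= acos_lepi.
have r2 : r / (2 * pi) <= 2^-1.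
  by rewrite ler_pdivrMr// mulrA mulVf// mul1r.
rewrite /=; case: ifPn => _.
  rewrite divr_ge0//= ?ltW//; lra.
case: ifPn => [_|rn0]; first by rewrite lexx ltr01.
have : 0 < r / (2 * pi) by rewrite divr_gt0// lt_neqAle eq_sym rn0.
lra.
Qed.

Lemma phaseP w : `|w| = 1 -> cis (2 * pi * phase w) = w.
Proof.
move=> /norm1P; case: w => x y /= w1.
have x1 : -1 <= x <= 1 by apply/andP; split; nra.
have pi0 : 2 * pi != 0 :> R by rewrite mulf_neq0 ?gt_eqF ?pi_gt0.
have rE : (if x <= -1 then pi else if 1 <= x then 0 else acos x) = acos x.
  case: ifPn => [xm|_].
    by rewrite (_ : x = -1) ?acosN1//; lra.
  by case: ifPn => // xp; rewrite (_ : x = 1) ?acos1//; lra.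
have sacos : sin (acos x) = `|y|.
  by rewrite sin_acos// -sqrtr_sqr; congr Num.sqrt; lra.
rewrite /phase /= rE; case: ifPn => [y0|].
  rewrite mulrC divfK// /cis sacos acosK ?in_itv//= ger0_norm//.
rewrite -ltNge => y0; case: ifPn => [/eqP a0|_].
  by move: sacos => /eqP; rewrite a0 sin0 eq_sym normr_eq0 (lt_eqF y0).
rewrite mulrBr mulr1 cisD cis_2pi mul1r mulrC divfK// /cis cosN sinN sacos.
by rewrite acosK ?in_itv//= ltr0_norm// opprK.
Qed.

Lemma phase_cis s : 0 <= s < 1 -> phase (cis (2 * pi * s)) = s.
Proof.
move=> s01; apply: cis_2pi_inj => //; first exact: phase_itv.
by rewrite phaseP// norm_cis.
Qed.

Lemma measurable_phase d (T : measurableType d) (f : T -> Cx R) :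
  measurable_fun setT (fun x => complex.Re (f x)) ->
  measurable_fun setT (fun x => complex.Im (f x)) ->
  measurable_fun setT (fun x => phase (f x)).
Proof.
move=> mre mim.
pose ac (x : R) := if x <= -1 then pi else if 1 <= x then 0 else acos x.
have mac : measurable_fun setT ac.
  apply: measurable_fun_if => //=.
    apply: measurable_fun_ler => //.
  rewrite setTI.
  have -> : (fun x : R => x <= -1) @^-1` [set false] = [set` `](-1:R), +oo[].
    by apply/seteqP; split=> x /=; rewrite in_itv/= andbT ltNge;
      [move=> ->|move=> /negbTE].
  apply: measurable_fun_if => //=.
  - exact: measurable_fun_ler.
  - apply: (@subspace_continuous_measurable_fun).
      apply: measurableI => //.
      rewrite -[X in measurable X]setTI.
      exact: (measurable_fun_ler (f := cst 1) (g := id)).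
    apply: continuous_in_subspaceT => x; rewrite inE/= in_itv/= andbT.
    move=> [x1 /negbT]; rewrite -ltNge => x2.
    by apply: continuous_acos; rewrite x1.
have mr : measurable_fun setT (fun x => ac (complex.Re (f x))).
  exact: measurableT_comp.
rewrite /phase -/(ac _).
apply: measurable_fun_ifT => //.
- exact: measurable_fun_ler.
- exact: measurable_funM.
apply: measurable_fun_ifT => //.
  by apply: measurable_fun_eqr.
apply: measurable_funB => //.
exact: measurable_funM.
Qed.

Lemma measurable_cos : measurable_fun setT (@cos R).
Proof. apply: continuous_measurable_fun; exact: continuous_cos. Qed.

Lemma measurable_sin : measurable_fun setT (@sin R).
Proof. apply: continuous_measurable_fun; exact: continuous_sin. Qed.

Lemma continuous_Re : continuous (fun w : Cx R => complex.Re w).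
Proof.
move=> w.
apply: (iffRL (@cvgrPdist_lt _ R^o _ (nbhs w) (nbhs_filter w) _ _)) => e e0.
near=> v.
have : `|w - v| < e%:C%C.
  by near: v; apply: cvgr_dist_lt => //; rewrite ltcR.
move/(le_lt_trans (normc_ge_Re _)); rewrite ltcR.
by rewrite raddfB.
Unshelve. all: by end_near. Qed.

Lemma continuous_Im : continuous (fun w : Cx R => complex.Im w).
Proof.
move=> w.
have -> : (fun w : Cx R => complex.Im w) = (fun w => - complex.Re (w * 'i%C)).
  by apply/funext => v; rewrite ReiNIm opprK.
apply: (@continuousN _ R^o (Cx R) (fun w0 : Cx R => complex.Re (w0 * 'i%C)) w).
apply: (@continuous_comp (Cx R) (Cx R) R (fun w => w * ('i%C : Cx R)) (@complex.Re R)).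
  exact: (@mulrr_continuous (R[i])).
exact: continuous_Re.
Qed.

Lemma cvg_complex (T : Type) (F : set_system T) {FF : Filter F} (f : T -> Cx R) w :
  complex.Re (f x) @[x --> F] --> complex.Re w ->
  complex.Im (f x) @[x --> F] --> complex.Im w -> f @ F --> w.
Proof.
move=> fr fi; apply/cvgrPdist_lt => e e0.
have eR : e = (complex.Re e)%:C%C :> R[i].
  by apply/esym/RRe_real; exact: gtr0_real.
have e'0 : 0 < complex.Re e by move: e0; rewrite eR ltcR.
near=> x.
have h1 : `|complex.Re w - complex.Re (f x)| < complex.Re e / 2.
  by near: x; apply: cvgr_dist_lt => //; rewrite divr_gt0.
have h2 : `|complex.Im w - complex.Im (f x)| < complex.Re e / 2.
  by near: x; apply: cvgr_dist_lt => //; rewrite divr_gt0.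
rewrite eR.
have := normc_def (w - f x : R[i]) => ->; rewrite ltcR.
have -> : complex.Re (w - f x) = complex.Re w - complex.Re (f x) by rewrite raddfB.
have -> : complex.Im (w - f x) = complex.Im w - complex.Im (f x) by rewrite raddfB.
move: h1 h2; set p := complex.Re w - _; set q := complex.Im w - _ => h1 h2.
rewrite -[ltRHS]ger0_norm ?ltW// -sqrtr_sqr ltr_sqrt ?exprn_gt0//.
have : `|p| ^+ 2 = p ^+ 2 by rewrite real_normK ?num_real.
have : `|q| ^+ 2 = q ^+ 2 by rewrite real_normK ?num_real.
have := normr_ge0 p; have := normr_ge0 q.
nra.
Unshelve. all: by end_near. Qed.

Lemma continuous_cis : continuous (fun a : R => cis a).
Proof.
by move=> a; apply: cvg_complex; [exact: continuous_cos|exact: continuous_sin].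
Qed.

End circle.

(** * Lebesgue measure under affine maps *)

Section translation.
Context {R : realType}.
Local Notation leb := (@lebesgue_measure R).

Lemma lebesgue_measure_shift (c : R) (A : set (measurableTypeR R)) :
  measurable A -> leb ((fun x => x + c) @^-1` A) = leb A.
Proof.
move=> mA.
have ms : measurable_fun setT ((fun x : R => x + c) : measurableTypeR R -> measurableTypeR R).
  exact: measurable_funD.
pose f : {mfun measurableTypeR R >-> measurableTypeR R} :=
  HB.pack (fun x : R => x + c) (isMeasurableFun.Build _ _ _ _ _ ms).
apply/esym.
apply: (@lebesgue_measure_unique R (pushforward leb f)) => //= _ [[a b]] _ <-.
rewrite /pushforward /=.
have -> : (fun x : R => x + c) @^-1` `]a, b]%classic = `](a - c), (b - c)]%classic.
  by apply/seteqP; split=> x /=; rewrite !in_itv/= ltrBlDr lerBrDr.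
rewrite !lebesgue_measure_itv/= !lte_fin ltrD2r.
by case: ifPn => // _; rewrite -!EFinB; congr EFin; ring.
Qed.

End translation.
Section affine.
Context {R : realType}.
Local Notation leb := (@lebesgue_measure R).
Local Open Scope ereal_scope.

Lemma integral_shift (f : R -> \bar R) (c : R) : measurable_fun setT f ->
  (forall x, 0 <= f x) -> \int[leb]_x f (x + c)%R = \int[leb]_x f x.
Proof.
move=> mf f0.
have ms : measurable_fun setT ((fun x : R => x + c)%R : measurableTypeR R -> measurableTypeR R).
  exact: measurable_funD.
have := @ge0_integral_pushforward _ _ _ _ R _ ms leb setT f measurableT mf (fun x _ => f0 x).
rewrite preimage_setT => <-.
apply: eq_measure_integral => A mA _.
exact: lebesgue_measure_shift.
Qed.

Lemma integral_scale (f : R -> \bar R) (c : R) : (0 < c)%R -> measurable_fun setT f ->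
  (forall x, 0 <= f x) -> c%:E * \int[leb]_x f (c * x)%R = \int[leb]_x f x.
Proof.
move=> c0 mf f0.
have ms : measurable_fun setT ((fun x : R => c * x)%R : measurableTypeR R -> measurableTypeR R).
  exact: measurable_funM.
have := @ge0_integral_pushforward _ _ _ _ R _ ms leb setT f measurableT mf (fun x _ => f0 x).
rewrite preimage_setT /= => <-.
pose cn : {nonneg R} := NngNum (ltW c0).
suff scale (m : {measure set (measurableTypeR R) -> \bar R}) :
    (forall A, measurable A -> m A = leb ((fun x => c * x)%R @^-1` A)) ->
    c%:E * \int[m]_x f x = \int[leb]_x f x by exact: scale.
move=> mE; rewrite -[c]/(cn%:num) -ge0_integral_mscale//.
apply: eq_measure_integral => A mA _.
apply/esym; apply: lebesgue_measure_unique => //= _ [[a b]] _ <-.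
rewrite /mscale /= mE//.
have -> : (fun x : R => c * x)%R @^-1` `]a, b]%classic = `](c^-1 * a)%R, (c^-1 * b)%R]%classic.
  apply/seteqP; split=> x /=; rewrite !in_itv/= => /andP[h1 h2];
    by move: h1 h2; rewrite ltr_pdivrMl// ler_pdivlMl// => -> ->.
rewrite !lebesgue_measure_itv/= !lte_fin ltr_pM2l ?invr_gt0//.
case: ifPn => _; last by rewrite mule0.
by rewrite -!EFinB -EFinM; congr EFin; rewrite -mulrBr mulrA divff ?mul1r// gt_eqF.
Qed.

End affine.

(** * Borel sets and supports *)

Definition borel_basis (M : topologicalType) (e : nat -> set M) : Prop :=
  (forall n, open (e n)) /\
  forall x U, open U -> U x -> exists n, e n x /\ e n `<=` U.

Lemma second_countable_enum (M : ptopologicalType) :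
  @second_countable M -> exists e : nat -> set M, borel_basis e.
Proof.
move=> [B cB [Bo Bb]].
have /pfcard_geP[B0|[f]] := cB.
  have /= := Bb point setT (@filterT _ (nbhs (point : M)) _).
  by move=> [V []]; rewrite B0.
exists f; split=> [n|x U oU Ux]; first by apply: Bo; exact: (@funS _ _ _ _ f).
have [V [BV Vx] VU] := Bb x U (open_nbhs_nbhs (conj oU Ux)).
have [n _ fn] := @surj _ _ _ _ f V BV.
by exists n; rewrite fn.
Qed.

Section borel.
Context {R : realType} {M : ptopologicalType}.
Hypothesis scM : @second_countable M.

Lemma borel_open (U : set M) : open U -> measurable (U : set (Borel M)).
Proof. by move=> oU; exact: sub_sigma_algebra. Qed.

Lemma borel_closed (F : set M) : closed F -> measurable (F : set (Borel M)).
Proof.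
move=> cF; rewrite -[F]setCK; apply: measurableC; apply: borel_open.
exact: closed_openC.
Qed.

(** For a member [V] of a countable basis of [M], the union of all open [J] with
    [J * V] inside [W] is open, so countably many open rectangles fill [W]. *)
Lemma measurable_open_product (W : set (R * M)) : open W ->
  measurable (W : set (measurableTypeR R * Borel M)).
Proof.
move=> oW; have [e [oe be]] := second_countable_enum scM.
pose I n := \bigcup_(J in [set J : set R | open J /\ J `*` e n `<=` W]) J.
have -> : W = \bigcup_n (I n `*` e n).
  apply/seteqP; split=> [[s x] Wp|[s x] [n _ [/= [J [oJ JW] Js] ex]]]; last first.
    exact: (JW (s, x)).
  have : nbhs (s, x) W by exact: open_nbhs_nbhs.
  move=> [[P Q] /= [Ps Qx] PQ].
  move: Qx; rewrite nbhsE => -[Q' [oQ' Q'x] Q'Q].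
  move: Ps; rewrite nbhsE => -[P' [oP' P's] P'P].
  have [n [enx enQ]] := be x Q' oQ' Q'x.
  exists n => //; split=> //=; exists P' => //; split=> //.
  by move=> [a b] [/= Pa /enQ/Q'Q Qb]; apply: PQ; split=> //; exact: P'P.
apply: bigcupT_measurable => n; apply: measurableX.
  by apply: open_measurable; apply: bigcup_open => J [].
exact: borel_open.
Qed.

Lemma measurable_continuous_product (f : R * M -> M) : continuous f ->
  measurable_fun setT (f : measurableTypeR R * Borel M -> Borel M).
Proof.
move=> cf; refine (@measurability _ _ (measurableTypeR R * Borel M)%type (Borel M) setT f (@open M) erefl _).
move=> _ [U oU <-]; rewrite setTI; apply: measurable_open_product.
by move/continuousP : cf; exact.
Qed.

Lemma measurable_continuous (f : M -> R) : continuous f ->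
  measurable_fun setT (f : Borel M -> measurableTypeR R).
Proof.
move=> cf; apply: (measurability _ (RGenOpens.measurableE R)).
move=> _ [_ [a [b ->] <-]]; rewrite setTI; apply: borel_open.
by move/continuousP : cf; apply; exact: interval_open.
Qed.

Lemma measurable_self_continuous (f : M -> M) : continuous f ->
  measurable_fun setT (f : Borel M -> Borel M).
Proof.
move=> cf; refine (@measurability _ _ (Borel M) (Borel M) setT f (@open M) erefl _).
move=> _ [U oU <-]; rewrite setTI; apply: borel_open.
by move/continuousP : cf; exact.
Qed.

Lemma measurable_within (X : set M) (f : M -> R) :
  closed X -> {within X, continuous f} ->
  measurable_fun setT (f \_ X : Borel M -> measurableTypeR R).
Proof.
move=> cX cf; have mX : measurable (X : set (Borel M)) by exact: borel_closed.
apply/(@measurable_restrictT _ _ (Borel M) _ _ f mX).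
apply: (measurability _ (RGenOpens.measurableE R)).
move=> _ [_ [a [b ->] <-]].
have oU : open (f @^-1` `]a, b[%classic : set (subspace X)).
  by move/continuousP : cf; apply; exact: interval_open.
have [V oV VX] := (open_subspaceP _ _).1 oU.
rewrite setIC -VX; apply: measurableI => //; exact: borel_open.
Qed.

Section support.
Variable mu : probability (Borel M) R.

Lemma closed_msupport : closed (msupport mu).
Proof.
rewrite -openC openE => x /existsNP[U /not_implyP[oU /not_implyP[Ux mU]]].
apply: (filterS _ (open_nbhs_nbhs (conj oU Ux))) => y Uy /(_ U oU Uy).
exact: mU.
Qed.

Lemma measurable_msupport : measurable (msupport mu : set (Borel M)).
Proof. by apply: borel_closed; exact: closed_msupport. Qed.

(** The complement of the support is the union of those members of a countable
    basis that are null. *)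
Lemma msupport_full : mu (msupport mu) = 1%E.
Proof.
have mX : measurable (msupport mu : set (Borel M)).
  exact: borel_closed closed_msupport.
have [e [oe be]] := second_countable_enum scM.
have mu0 : mu.-negligible (~` msupport mu).
  pose F n := if `[< mu (e n) = 0%E >] then e n else set0.
  apply: (@negligibleS _ (Borel M) R mu (\bigcup_n F n)).
    move=> x /existsNP[U /not_implyP[oU /not_implyP[Ux mU]]].
    have [n [enx enU]] := be x U oU Ux.
    exists n => //; rewrite /F; case: asboolP => // en0; case: en0.
    apply/eqP; rewrite -measure_le0 leNgt; apply/negP => en0; apply: mU.
    by apply: lt_le_trans en0 _; apply: le_measure; rewrite ?inE//; exact: borel_open.
  apply: negligible_bigcup => n; rewrite /F; case: asboolP => [e0|_].
    by exists (e n); split=> //; exact: borel_open.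
  exact: negligible_set0.
have := probability_setC mu mX.
move/negligibleP: mu0 => ->; last exact: measurableC.
have : mu (msupport mu) \is a fin_num by exact: fin_num_measure.
by case: (mu _) => // r _ /= [] /eqP; rewrite eq_sym subr_eq0 => /eqP ->.
Qed.

(** A nonempty relatively open part of the support has positive measure. *)
Lemma support_cst (f : M -> Cx R) c : {within msupport mu, continuous f} ->
  {ae mu, forall x, msupport mu x -> f x = c} ->
  forall x, msupport mu x -> f x = c.
Proof.
move=> cf fc x Xx; apply: contrapT => fxc.
have oc : nbhs (f x) (~` [set c]).
  apply: open_nbhs_nbhs; split; last exact: fxc.
  apply: closed_openC; apply: accessible_closed_set1.
  by apply: hausdorff_accessible; exact: norm_hausdorff.
have : within (msupport mu) (nbhs x) [set y | f y <> c].
  by rewrite (nbhs_subspace_in Xx); exact: (cf x _ oc).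
rewrite /within /= nbhsE => -[U [oU Ux] UX].
have := Xx U oU Ux; rewrite (_ : mu U = 0%E) ?ltxx//.
apply/negligibleP; first exact: borel_open.
have nX : mu.-negligible (~` msupport mu).
  apply/negligibleP; first by apply: measurableC; exact: measurable_msupport.
  have := probability_setC mu measurable_msupport.
  by rewrite msupport_full subee.
apply: negligibleS (negligibleU fc nX) => y Uy.
have [Xy|] := pselect (msupport mu y); [left|by right].
by move/(_ Xy); exact: UX.
Qed.

End support.

Section approximation.
Hypothesis crM : completely_regular_space M.

(** Complete regularity provides, for members [V] of a countable basis that cover
    [U], continuous functions that exceed 1/2 on [V] and vanish off [U].  Adding the
    first [m] of them, multiplying by [m] and cutting off at 1 gives [phi m]. *)
Lemma open_approximation (U : set M) : open U ->
  exists phi : nat -> M -> R, [/\ forall m, continuous (phi m),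
    forall m x, 0 <= phi m x <= 1,
    forall x, nondecreasing_seq (phi^~ x) &
    forall x, phi^~ x @ \oo --> (\1_U x : R)].
Proof.
move=> oU; have [e [oe be]] := second_countable_enum scM.
pose good (V : set M) (g : M -> R) := [/\ continuous g,
  forall x, 0 <= g x <= 1, forall x, ~ U x -> g x = 0 & forall x, V x -> 2^-1 < g x].
have [g gP] : exists g : nat -> M -> R, forall n,
    [/\ continuous (g n), forall x, 0 <= g n x <= 1, forall x, ~ U x -> g n x = 0 &
      (exists h, good (e n) h) -> forall x, e n x -> 2^-1 < g n x].
  suff /choice[g gP] : forall n, exists gn : M -> R,
    [/\ continuous gn, forall x, 0 <= gn x <= 1, forall x, ~ U x -> gn x = 0 &
      (exists h, good (e n) h) -> forall x, e n x -> 2^-1 < gn x] by exists g.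
  move=> n.
  have [[h [h1 h2 h3 h4]]|nh] := pselect (exists h, good (e n) h).
    by exists h.
  exists (cst 0); split=> // [|x]; first exact: cst_continuous.
  by rewrite lexx ler01.
pose s m x : R := \sum_(k < m) g k x.
have s0 m x : 0 <= s m x.
  by apply: sumr_ge0 => k _; have [_ /(_ x)/andP[]] := gP k.
exists (fun m x => Num.min 1 (m%:R * s m x)); split.
- move=> m x; apply: (@continuous_min R M (cst 1) (fun x => m%:R * s m x)).
    exact: cst_continuous.
  apply: (@continuousM R M (cst m%:R) (s m)); first exact: cst_continuous.
  have -> : s m = (\sum_(k < m) g k : M -> R).
    by apply/funext => y; rewrite /s fct_sumE.
  apply: (big_ind (fun f : M -> R => {for x, continuous f})).
  + exact: cst_continuous.
  + by move=> f1 f2 c1 c2; exact: continuousD.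
  + by move=> k _; have [c _ _ _] := gP k; exact: c.
- move=> m x; rewrite ge_min lexx/= andbT le_min ler01/=.
  by rewrite mulr_ge0.
- move=> x m p mp; rewrite le_min; apply/andP; split; first by rewrite ge_min lexx.
  rewrite ge_min; apply/orP; right.
  apply: ler_pM => //; rewrite ?ler_nat//.
  rewrite /s -!(big_mkord xpredT (fun k => g k x)).
  rewrite (big_cat_nat (n := m) _ mp)//= lerDl.
  by apply: sumr_ge0 => k _; have [_ /(_ x)/andP[]] := gP k.
- move=> x; have [Ux|nUx] := pselect (U x); last first.
    rewrite indicE memNset//= (_ : (fun m => _) = cst 0); first exact: cvg_cst.
    apply/funext => m; rewrite /s big1 ?mulr0 ?min_r//.
    by move=> k _; have [_ _ -> //] := gP k.
  rewrite indicE mem_set//=.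
  have [n [enx en]] : exists n, e n x /\ exists h, good (e n) h.
    have ncU : ~ (~` U) x by move=> /(_ Ux).
    have /(@uniform_separatorP _ R)[f [cf f01 f0 f1]] := crM (open_closedC oU) ncU.
    pose V := [set y | f y < 2^-1].
    have oV : open (f @^-1` [set r | r < 2^-1]).
      by move/continuousP : cf; apply; exact: open_lt.
    have Vx : V x.
      rewrite /V /= (_ : f x = 0); first by rewrite invr_gt0.
      by apply: f0; exists x.
    have [n [enx enV]] := be x V oV Vx.
    exists n; split=> //; exists (fun y => 1 - f y); split.
    + move=> y; apply: (@continuousB R R^o M (cst 1) f); first exact: cst_continuous.
      exact: cf.
    + move=> y; have /(_ (f y)) := f01.
      have fy : range f (f y) by exists y.
      by move=> /(_ fy); rewrite /= in_itv/= => /andP[a b]; apply/andP; split; lra.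
    + move=> y nUy; have : [set 1] (f y) by apply: f1; exists y.
      by move=> ->; rewrite subrr.
    + move=> y /enV; rewrite /V /=; lra.
  apply: cvg_near_cst; exists (maxn 2 n.+1) => // m /=.
  rewrite geq_max => /andP[m2 nm]; apply/eqP; rewrite eq_sym; apply/eqP.
  rewrite min_l//.
  have gn : 2^-1 <= g n x by have [_ _ _ /(_ en x enx)/ltW] := gP n.
  have sm : 2^-1 <= s m x.
    apply: (le_trans gn); rewrite /s (bigD1 (Ordinal nm))//= lerDl.
    by apply: sumr_ge0 => k _; have [_ /(_ x)/andP[]] := gP k.
  have m2' : 2 <= m%:R :> R by rewrite (ler_nat _ 2 m).
  nra.
Qed.

End approximation.
End borel.

(** * Charts *)

(** The inverse of a chart carries a closed ball of the model space onto a compact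
    neighbourhood.  Local compactness makes [M] completely regular, so that there
    are enough continuous test functions for [conditional_unique]. *)
Lemma atlas_locally_compact (R : realType) n (M : ptopologicalType)
  (A : @C1_atlas R n M) : hausdorff_space M -> locally_compact [set: M].
Proof.
move=> hM x _; have [i ix] := chart_cover A x.
have oC : open (chart i @` chart_dom i) by exact: chart_img_open.
have Cx : (chart i @` chart_dom i) (chart i x) by exists x.
have /nbhs_closedballP[e eC] := open_nbhs_nbhs (conj oC Cx).
pose B := closed_ball (chart i x) e%:num.
have cK : compact (chart_inv i @` B).
  apply: continuous_compact; last first.
    apply: bounded_closed_compact; last exact: closed_ball_closed.
    exists (`|chart i x| + e%:num); split; first exact: num_real.
    move=> r /ltW er y; rewrite /B closed_ballE// /closed_ball_ /= => xy.
    rewrite (le_trans _ er)// -[y](subrK (chart i x)) addrC.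
    by rewrite (le_trans (ler_normD _ _))// lerD2l distrC.
  exact: continuous_subspaceW eC (@chart_inv_cont _ _ _ A i).
exists (chart_inv i @` B); last by split=> //; exact: compact_closed.
suff : nbhs x (chart_inv i @` B) by apply: filterS.
have oD := @chart_dom_open _ _ _ A i.
have cc : {in chart_dom i, continuous (chart i)}.
  rewrite -continuous_open_subspace//; exact: chart_cont.
have xB : nbhs x (chart i @^-1` B).
  have nB : nbhs (chart i x) B by apply/nbhs_closedballP; exists e.
  exact: (cc x (mem_set ix) B nB).
have := open_nbhs_nbhs (conj oD ix); apply: filterS2 xB => y Bz iy.
by exists (chart i y) => //; exact: chartK.
Qed.

(** * Null sets and images of measures *)

Section sections.
Context d1 d2 (T1 : measurableType d1) (T2 : measurableType d2) (R : realType).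
Variable m1 : {sigma_finite_measure set T1 -> \bar R}.
Variable m2 : {sigma_finite_measure set T2 -> \bar R}.

Lemma integral_sections (W : set (T1 * T2)) : measurable W ->
  (\int[m1]_x m2 (xsection W x) = \int[m2]_y m1 (ysection W y))%E.
Proof.
move=> mW; have := indic_fubini_tonelli m1 m2 mW.
by rewrite indic_fubini_tonelli_FE// indic_fubini_tonelli_GE.
Qed.

(** The measure of [W] may be computed from either family of sections. *)
Lemma null_sections (W : set (T1 * T2)) : measurable W ->
  (forall x, m2 (xsection W x) = 0%E) -> {ae m2, forall y, m1 (ysection W y) = 0%E}.
Proof.
move=> mW W0.
have i0 : (\int[m2]_y m1 (ysection W y) = 0)%E.
  by rewrite -integral_sections//; apply: integral0_eq => x _; rewrite W0.
have mf : measurable_fun setT (fun y => m1 (ysection W y)).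
  exact: measurable_fun_ysection.
have := (ae_eq_integral_abs m2 measurableT mf).1.
under eq_integral do rewrite gee0_abs//.
move=> /(_ i0); apply: filterS => y /=; exact.
Qed.

End sections.

Section ae.
Context d (T : measurableType d) (R : realType) (mu : probability T R).

Lemma ae_sub (P Q : T -> Prop) : (forall x, P x -> Q x) ->
  {ae mu, forall x, P x} -> {ae mu, forall x, Q x}.
Proof. by move=> PQ; apply: negligibleS => x nQ /PQ. Qed.

Lemma ae_sub2 (P Q S : T -> Prop) : (forall x, P x -> Q x -> S x) ->
  {ae mu, forall x, P x} -> {ae mu, forall x, Q x} -> {ae mu, forall x, S x}.
Proof.
move=> PQS hP hQ; apply: (negligibleS _ (negligibleU hP hQ)) => x nS.
by have [Px|] := pselect (P x); [right=> /(PQS _ Px)|left].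
Qed.

Lemma ae_full_subset (P : T -> Prop) : {ae mu, forall x, P x} ->
  exists2 B : set T, measurable B & B `<=` P /\ mu B = 1%E.
Proof.
move=> [N [mN N0 NP]]; exists (~` N); first exact: measurableC.
split; last by rewrite probability_setC// N0 sube0.
by move=> x Nx; apply: contrapT => nP; apply: Nx; exact: NP.
Qed.

Lemma full_ae (B : set T) : measurable B -> mu B = 1%E -> {ae mu, forall x, B x}.
Proof.
move=> mB B1; exists (~` B); split; first exact: measurableC.
  by rewrite probability_setC// B1 subee.
by move=> x.
Qed.

End ae.

Section image.
Context d d' (T : measurableType d) (T' : measurableType d') (R : realType).
Variables (P : probability T R) (f : T -> T') (mf : measurable_fun setT f).

Definition image_probability : probability T' R :=
  distribution P (HB.pack f (isMeasurableFun.Build _ _ _ _ _ mf) : {mfun T >-> T'}).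

Lemma ge0_integral_image (g : T' -> \bar R) : measurable_fun setT g ->
  (forall x, 0 <= g x)%E ->
  (\int[image_probability]_x g x = \int[P]_x g (f x))%E.
Proof. by move=> mg g0; rewrite /image_probability ge0_integral_distribution. Qed.

Lemma ae_image (Q : T' -> Prop) : {ae image_probability, forall x, Q x} ->
  {ae P, forall x, Q (f x)}.
Proof.
move=> [N [mN N0 NQ]]; exists (f @^-1` N); split=> //; last by move=> x /= /NQ.
by rewrite -[X in measurable X]setTI; exact: mf.
Qed.

End image.

(** * Invariant sets of a flow *)

Section flow.
Context {R : realType} {M : ptopologicalType}.
Hypothesis scM : @second_countable M.
Variable Phi : R -> M -> M.
Hypothesis Phi0 : forall x, Phi 0 x = x.
Hypothesis PhiD : forall s t x, Phi (s + t) x = Phi s (Phi t x).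
Hypothesis PhiC : continuous (fun p : R * M => Phi p.1 p.2).

Local Notation leb := (@lebesgue_measure R).

Lemma PhiK t x : Phi (- t) (Phi t x) = x.
Proof. by rewrite -PhiD addNr Phi0. Qed.

Lemma PhiNK t x : Phi t (Phi (- t) x) = x.
Proof. by rewrite -PhiD subrr Phi0. Qed.

Lemma continuous_time t : continuous (Phi t).
Proof.
move=> x; apply: (@continuous_comp _ _ _ (fun x : M => (t, x)) (fun p : R * M => Phi p.1 p.2)).
  move=> U [[P Q] /= [Pt Qx] PQU]; apply: filterS Qx => y Qy; apply: PQU.
  by split=> //; exact: nbhs_singleton.
exact: PhiC.
Qed.

Lemma measurable_flow :
  measurable_fun setT (fun p : measurableTypeR R * Borel M => Phi p.1 p.2 : Borel M).
Proof. exact: measurable_continuous_product PhiC. Qed.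

Lemma measurable_time t :
  measurable_fun setT (Phi t : Borel M -> Borel M).
Proof. exact: measurable_self_continuous (@continuous_time t). Qed.

Lemma measurable_time_preimage t (B : set (Borel M)) :
  measurable B -> measurable (Phi t @^-1` B : set (Borel M)).
Proof. by move=> mB; rewrite -[X in measurable X]setTI; exact: measurable_time. Qed.

Lemma measurable_flow_preimage (B : set (Borel M)) : measurable B ->
  measurable ([set p | B (Phi p.1 p.2)] : set (measurableTypeR R * Borel M)).
Proof. by move=> mB; rewrite -[X in measurable X]setTI; exact: measurable_flow. Qed.

Variable mu : probability (Borel M) R.
Hypothesis mu_inv : flow_invariant mu Phi.

Lemma msupport_invariant t x : msupport mu x -> msupport mu (Phi t x).
Proof.
move=> Xx U oU Ux; rewrite -(mu_inv t); last exact: borel_open.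
have oV : open (Phi t @^-1` U) by move/continuousP : (@continuous_time t); exact.
exact: Xx oV Ux.
Qed.

(** The points whose orbit stays in [B] at almost all times.  Unlike the set of
    points whose whole orbit stays in [B], it is Borel by Fubini. *)
Definition orbit_ae (B : set M) : set M := [set x | leb [set t | ~ B (Phi t x)] = 0%E].

Section orbit_ae.
Variable B : set (Borel M).
Hypothesis mB : measurable B.
Let W : set (measurableTypeR R * Borel M) := [set p | ~ B (Phi p.1 p.2)].
Let mW : measurable W.
Proof. exact: (measurable_flow_preimage (measurableC mB)). Qed.

Let WE x : [set t | ~ B (Phi t x)] = ysection W x.
Proof. by rewrite ysectionE. Qed.

Lemma measurable_orbit_ae : measurable (orbit_ae B : set (Borel M)).
Proof.
have mf := measurable_fun_ysection leb mW.
rewrite -[X in measurable X]setTI.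
rewrite (_ : orbit_ae B = (fun x => leb (ysection W x)) @^-1` [set 0%E]).
  exact: mf.
by apply/seteqP; split=> x; rewrite /orbit_ae /= WE.
Qed.

Lemma orbit_ae_invariant t x : orbit_ae B x -> orbit_ae B (Phi t x).
Proof.
rewrite /orbit_ae /= => <-; rewrite [in RHS]WE.
rewrite -[in RHS](@lebesgue_measure_shift R t); last exact: measurable_ysection.
by congr (leb _); apply/seteqP; split=> s; rewrite /= ysectionE /W /= PhiD.
Qed.

(** At every single time the exceptional points form a null set; by Fubini almost
    every point has a null set of exceptional times. *)
Lemma orbit_ae_full : mu B = 1%E -> mu (orbit_ae B) = 1%E.
Proof.
move=> B1.
have B0 : mu (~` B) = 0%E by rewrite probability_setC// B1 subee.
have [N [mN N0 NP]] : {ae mu, forall x, leb (ysection W x) = 0%E}.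
  apply: null_sections => // t; rewrite -B0 -(mu_inv t) ?xsectionE//.
  exact: measurableC.
apply/eqP; rewrite eq_le probability_le1 ?andTb//=; last exact: measurable_orbit_ae.
have <- : mu (~` N) = 1%E by rewrite probability_setC// N0 sube0.
apply: le_measure; rewrite ?inE.
- exact: measurableC.
- exact: measurable_orbit_ae.
move=> x /= Nx; rewrite /orbit_ae /= WE; apply: contrapT => h.
by apply: Nx; exact: NP.
Qed.

End orbit_ae.

Lemma orbit_ae_ex (B : set M) x : orbit_ae B x -> exists t, B (Phi t x).
Proof.
move=> xB; apply: contrapT => /forallNP h.
move: xB; rewrite /orbit_ae /= (_ : [set t | _] = setT).
  by rewrite -set_itvNyy lebesgue_measure_itv.
by apply/seteqP; split=> // s _; exact: h.
Qed.

(** An orbit that lies at almost all times in a Borel part of [P] meets [P], and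
    so lies in [P]. *)
Lemma invariant_borel_core (P : set M) : (forall t x, P x -> P (Phi t x)) ->
  {ae mu, forall x, P x} ->
  exists G : set (Borel M), [/\ measurable G, G `<=` P,
    forall t x, G x -> G (Phi t x) & mu G = 1%E].
Proof.
move=> Pinv /ae_full_subset[B mB [BP B1]]; exists (orbit_ae B); split.
- exact: measurable_orbit_ae.
- move=> x /orbit_ae_ex[t Bt]; rewrite -(PhiK t x).
  exact/Pinv/BP.
- by move=> t x; exact: orbit_ae_invariant.
- exact: orbit_ae_full.
Qed.

Hypothesis mu_erg : flow_ergodic mu Phi.

(** Ergodicity speaks of strictly invariant sets; the intersection of [B] with an
    invariant Borel core of the good points is one. *)
Lemma ergodic_ae (B : set (Borel M)) : measurable B ->
  {ae mu, forall x, forall t, B (Phi t x) <-> B x} -> mu B = 0%E \/ mu B = 1%E.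
Proof.
move=> mB Binv.
have [|G [mG GP Ginv G1]] := invariant_borel_core _ Binv.
  by move=> t x H s; rewrite -PhiD H; apply: iff_sym; exact: H.
have -> : mu B = mu (B `&` G).
  have G0 : mu (~` G) = 0%E by rewrite probability_setC// G1 subee.
  apply/eqP; rewrite eq_le; apply/andP; split; last first.
    by apply: le_measure; rewrite ?inE//; exact: measurableI.
  rewrite -[leRHS]adde0 -G0.
  apply: le_trans (measureU2 _ _ _); rewrite ?le_measure ?inE//.
  - by apply: measurableU; [exact: measurableI|exact: measurableC].
  - by move=> x Bx; have [Gx|nGx] := pselect (G x); [left|right].
  - exact: measurableI.
  - exact: measurableC.
apply: mu_erg; first exact: measurableI.
move=> t; apply/seteqP; split=> x /= [Bx Gx].
  have {}Gx : G x by rewrite -(PhiK t x); exact: Ginv.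
  by split=> //; apply/(GP _ Gx t).
by split; [apply/(GP _ Gx t)|exact: Ginv].
Qed.

(** Each sublevel set of [f] has measure 0 or 1, and the constant is the level at
    which the measure jumps. *)
Lemma ergodic_cst (f : M -> R) : measurable_fun setT (f : Borel M -> R) ->
  {ae mu, forall x, `|f x| <= 1} -> {ae mu, forall x, forall t, f (Phi t x) = f x} ->
  exists c, {ae mu, forall x, f x = c}.
Proof.
move=> mf f1 finv.
pose L r : set (Borel M) := [set x | f x < r].
have mL r : measurable (L r).
  rewrite -[X in measurable X]setTI.
  exact: (measurable_fun_ltr mf (measurable_cst r)).
have L01 r : mu (L r) = 0%E \/ mu (L r) = 1%E.
  apply: ergodic_ae => //; apply: ae_sub finv => x xi t.
  by rewrite /L /= xi.
have L_le r s : r <= s -> (mu (L r) <= mu (L s))%E.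
  move=> rs; apply: le_measure; rewrite ?inE// => x /lt_le_trans; exact.
pose S := [set r | mu (L r) = 0%E].
have Sm1 : S (-1).
  rewrite /S /=; apply/negligibleP => //; move: f1; apply: negligibleS => x /=.
  by rewrite /L /= ler_norml => xr /andP[]; rewrite leNgt xr.
have S2 : ubound S 2.
  move=> r /= Sr; rewrite leNgt; apply/negP => r2.
  have : mu (L r) = 1%E.
    apply/eqP; rewrite eq_le probability_le1//=.
    have [B mB [BP <-]] := ae_full_subset f1.
    apply: le_measure; rewrite ?inE// => x /BP; rewrite ler_norml /L /=; lra.
  by rewrite Sr => /eqP; rewrite eq_sym onee_eq0.
have hS : has_sup S by split; [exists (-1)|exists 2].
exists (sup S).
have below r : r < sup S -> {ae mu, forall x, r <= f x}.
  move=> rS; have [s Ss rs] := sup_gt (ex_intro _ _ Sm1) rS.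
  have : mu.-negligible (L r).
    apply/negligibleP => //; apply/eqP; rewrite -measure_le0 -Ss.
    by apply: L_le; exact: ltW.
  by apply: negligibleS => x /=; rewrite /L /= ltNge => /negP.
have above r : sup S < r -> {ae mu, forall x, f x < r}.
  move=> rS; have [Lr|L1] := L01 r; last exact: (full_ae (mL r) L1).
  have : r <= sup S by exact: sup_upper_bound.
  by rewrite leNgt rS.
have h1 : {ae mu, forall x, forall k : nat, sup S - k.+1%:R^-1 <= f x}.
  by apply: ae_foralln => k; apply: below; rewrite ltrBlDr ltrDl invr_gt0 ltr0n.
have h2 : {ae mu, forall x, forall k : nat, f x < sup S + k.+1%:R^-1}.
  by apply: ae_foralln => k; apply: above; rewrite ltrDl invr_gt0 ltr0n.
apply: ae_sub2 h1 h2 => x a1 a2; apply/eqP; rewrite eq_le; apply/andP; split.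
  apply/ler_addgt0Pr => e e0.
  have := a2 (Num.truncn e^-1); move/ltW/le_trans; apply; rewrite lerD2l.
  rewrite -[leRHS]invrK lef_pV2 ?posrE ?invr_gt0 ?ltr0n//.
  exact/ltW/truncnS_gt.
apply/ler_addgt0Pr => e e0.
have := a1 (Num.truncn e^-1); rewrite lerBlDr; move/le_trans; apply; rewrite lerD2l.
rewrite -[leRHS]invrK lef_pV2 ?posrE ?invr_gt0 ?ltr0n//.
exact/ltW/truncnS_gt.
Qed.

End flow.

(** * Eigenfunctions along orbits *)

Section complex_measurable.
Context {R : realType} d (T : measurableType d).

(** Complex measurability on any measurable space; the product of the time axis and
    [M] is the case of interest. *)
Definition cmeas (f : T -> Cx R) : Prop :=
  measurable_fun setT (fun x => complex.Re (f x)) /\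
  measurable_fun setT (fun x => complex.Im (f x)).

Lemma cmeas_mul (f h : T -> Cx R) : cmeas f -> cmeas h ->
  cmeas (fun x => f x * h x).
Proof.
move=> [fr fi] [hr hi]; split.
  rewrite (_ : (fun x => _) = (fun x => complex.Re (f x) * complex.Re (h x) -
     complex.Im (f x) * complex.Im (h x))).
    by apply: measurable_funB; exact: measurable_funM.
  by apply/funext => x; case: (f x) => a b; case: (h x).
rewrite (_ : (fun x => _) = (fun x => complex.Re (f x) * complex.Im (h x) +
   complex.Im (f x) * complex.Re (h x))).
  by apply: measurable_funD; exact: measurable_funM.
by apply/funext => x; case: (f x) => a b; case: (h x).
Qed.

Lemma cmeas_cis (f : T -> R) : measurable_fun setT f -> cmeas (fun x => cis (f x)).
Proof.
move=> mf; split; apply: (measurableT_comp _ mf).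
  exact: measurable_cos.
exact: measurable_sin.
Qed.

Lemma cmeas_comp d' (T' : measurableType d') (f : T -> Cx R) (h : T' -> T) :
  cmeas f -> measurable_fun setT h ->
  measurable_fun setT (fun x => complex.Re (f (h x))) /\
  measurable_fun setT (fun x => complex.Im (f (h x))).
Proof.
by move=> [fr fi] mh; split; [exact: (measurableT_comp fr)|exact: (measurableT_comp fi)].
Qed.

Lemma measurable_neq_complex (f h : T -> Cx R) : cmeas f -> cmeas h ->
  measurable [set x | f x <> h x].
Proof.
move=> [fr fi] [hr hi].
have mr := measurable_fun_eqr fr hr; have mi := measurable_fun_eqr fi hi.
have m1 := mr measurableT [set true] I; have m2 := mi measurableT [set true] I.
rewrite (_ : [set x | _] = ~` ((setT `&` (fun x => complex.Re (f x) == complex.Re (h x)) @^-1` [set true])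
   `&` (setT `&` (fun x => complex.Im (f x) == complex.Im (h x)) @^-1` [set true]))).
  exact/measurableC/measurableI.
apply/seteqP; split=> x /=.
  move=> fh [[_ /eqP e1] [_ /eqP e2]]; apply: fh.
  by move: e1 e2; case: (f x) => a b; case: (h x) => a' b' /= -> ->.
by move=> fh e; apply: fh; rewrite e !eqxx.
Qed.

End complex_measurable.

Section eigen.
Context {R : realType} {M : ptopologicalType}.
Hypothesis scM : @second_countable M.
Variable Phi : R -> M -> M.
Hypothesis Phi0 : forall x, Phi 0 x = x.
Hypothesis PhiD : forall s t x, Phi (s + t) x = Phi s (Phi t x).
Hypothesis PhiC : continuous (fun p : R * M => Phi p.1 p.2).
Variable mu : probability (Borel M) R.
Hypothesis mu_inv : flow_invariant mu Phi.

Local Notation leb := (@lebesgue_measure R).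

Lemma ae_time (P : M -> Prop) t : {ae mu, forall x, P x} ->
  {ae mu, forall x, P (Phi t x)}.
Proof.
move=> [N [mN N0 NP]]; exists (Phi t @^-1` N); split; last first.
- by move=> x /= nP; apply: NP.
- by rewrite mu_inv.
- exact: measurable_time_preimage.
Qed.

Definition time_mean (h : R * M -> R) (x : M) : R :=
  fine (\int[leb]_(t in `[0, 1]) (h (t, x))%:E).

Lemma measurable_time_mean (h : R * M -> R) :
  measurable_fun setT (h : measurableTypeR R * Borel M -> R) ->
  measurable_fun setT (time_mean h : Borel M -> R).
Proof.
move=> mh; apply: measurableT_comp => //.
pose D : set (measurableTypeR R * Borel M) := `[0, 1]%classic `*` setT.
pose f (p : measurableTypeR R * Borel M) : \bar R := (h p * \1_D p)%:E.
have mD : measurable D by apply: measurableX.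
have mf : measurable_fun setT f.
  apply/measurable_EFinP; apply: measurable_funM => //.
rewrite (_ : (fun x => _) = (fun x => \int[leb]_t (f^\+ (t, x)) - \int[leb]_t (f^\- (t, x)))%E).
  apply: emeasurable_funB.
    apply: (@measurable_fun_fubini_tonelli_G _ _ _ _ _ leb f^\+%E) => //.
    exact: measurable_funepos.
  apply: (@measurable_fun_fubini_tonelli_G _ _ _ _ _ leb f^\-%E) => //.
  exact: measurable_funeneg.
apply/funext => x; rewrite integral_mkcond integralE.
congr (_ - _)%E; apply: eq_integral => t _; rewrite ?funeposE ?funenegE /f /= patchE indicE in_setX/= in_setT andbT;
  by case: ifPn; rewrite ?mulr1 ?mulr0.
Qed.

(** For almost every [x], [w (t, x) = cis (- omega t) g (Phi t x)] equals [g x] at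
    almost all [t], and its average over [0 <= t <= 1] recovers that constant.  The
    averages obey the eigenfunction equation exactly wherever [w (t, x)] is
    constant at almost all [t], because the flow shifts [t] and multiplies the
    constant by [cis (omega s)]. *)
Lemma orbitwise_version_exists (omega : R) (z : M -> Cx R) :
  koopman_eigen_L2 mu Phi omega z ->
  exists z1, orbitwise_version mu Phi omega z z1.
Proof.
move=> [[g [mg zg _]] zeig].
pose w (p : measurableTypeR R * Borel M) : Cx R := cis (- (omega * p.1)) * g (Phi p.1 p.2).
have mgPhi : cmeas (fun p : measurableTypeR R * Borel M => g (Phi p.1 p.2)).
  exact: (cmeas_comp mg (measurable_flow scM PhiC)).
have mw : cmeas w.
  apply: cmeas_mul => //; apply: cmeas_cis; apply: measurableT_comp => //.
  by apply: measurable_funM => //; exact: measurable_fst.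
have mgsnd : cmeas (fun p : measurableTypeR R * Borel M => g p.2).
  by apply: (cmeas_comp mg); exact: measurable_snd.
have mW := measurable_neq_complex mw mgsnd.
set W := [set p | _] in mW.
have W0 t : mu (xsection W t) = 0%E.
  apply/negligibleP; first exact: measurable_xsection.
  have h : {ae mu, forall x, z (Phi t x) = cis (omega * t) * g x}.
    by apply: ae_sub2 zg (zeig t) => x <-.
  have : {ae mu, forall x, w (t, x) = g x}.
    apply: ae_sub2 h (ae_time t zg) => x + e.
    rewrite e /w /= => ->; rewrite mulrA -cisD addNr cis0 mul1r//.
  by apply: negligibleS => x; rewrite xsectionE.
have secE x : ysection W x = [set t | w (t, x) <> g x] by rewrite ysectionE.
pose P := [set x | exists c, leb [set t | w (t, x) <> c] = 0%E].
have aeP : {ae mu, forall x, leb [set t | w (t, x) <> g x] = 0%E}.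
  by apply: ae_sub (@null_sections _ _ _ _ R leb mu W mW W0) => x; rewrite secE.
have mwx (x : M) : cmeas (fun t : measurableTypeR R => w (t, x)).
  apply: cmeas_comp mw _; exact: measurable_fun_pair.
have mne x c : measurable [set t : measurableTypeR R | w (t, x) <> c].
  by apply: measurable_neq_complex => //; split; exact: measurable_cst.
pose z1 x : Cx R := (time_mean (fun p => complex.Re (w p)) x +i*
  time_mean (fun p => complex.Im (w p)) x)%C.
have z1E x c : leb [set t | w (t, x) <> c] = 0%E -> z1 x = c.
  move=> wc.
  have mean (f : Cx R -> R) : measurable_fun setT (fun t : measurableTypeR R => f (w (t, x))) ->
      time_mean (fun p => f (w p)) x = f c.
    move=> mf; rewrite /time_mean.
    rewrite (@ae_eq_integral _ _ _ leb _ (cst (f c)%:E))//.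
    - by rewrite integral_cst//= lebesgue_measure_itv/= lte_fin ltr01 oppr0 adde0 mule1.
    - by apply/measurable_EFinP; exact: measurable_funS mf.
    - exists [set t | w (t, x) <> c]; split=> // t /= /not_implyP[_ h] e.
      by apply: h; rewrite e.
  have [mre mim] := mwx x.
  by rewrite /z1 (mean _ mre) (mean _ mim); case: (c).
have Pinv s x c : leb [set t | w (t, x) <> c] = 0%E ->
    leb [set t | w (t, Phi s x) <> cis (omega * s) * c] = 0%E.
  move=> <-; rewrite -[in RHS](@lebesgue_measure_shift R s); last exact: mne.
  congr (leb _); apply/seteqP.
  have e t : w (t + s, x) = cis (- (omega * s)) * w (t, Phi s x).
    by rewrite /w /= PhiD mulrA -cisD; congr (cis _ * _); ring.
  have e2 t : w (t + s, x) = c <-> w (t, Phi s x) = cis (omega * s) * c.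
    rewrite e; split=> [<-|->]; rewrite mulrA -cisD ?subrr ?addNr cis0 mul1r//.
  by split=> t /= h /e2.
exists z1; split.
- split.
    apply: (measurable_time_mean (h := fun p => complex.Re (w p))).
    by case: mw.
  apply: (measurable_time_mean (h := fun p => complex.Im (w p))).
  by case: mw.
- by apply: ae_sub2 zg aeP => x -> /z1E.
- apply: ae_sub aeP => x h t.
  by rewrite (z1E x _ h) (z1E _ _ (Pinv t x _ h)).
Qed.

Lemma eigenfrequency0 (mu_erg : flow_ergodic mu Phi) (z : M -> Cx R) : cmeasurable z ->
  {ae mu, forall x, `|z x| = 1} ->
  {ae mu, forall x, forall t, z (Phi t x) = cis (0 * t) * z x} ->
  exists c, {ae mu, forall x, z x = c}.
Proof.
move=> [mr mi] z1 zinv.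
have h t x : z (Phi t x) = cis (0 * t) * z x -> z (Phi t x) = z x.
  by rewrite mul0r cis0 mul1r.
have [||a ha] := ergodic_cst scM Phi0 PhiD PhiC mu_inv mu_erg mr.
- apply: ae_sub z1 => x /norm1P e.
  by rewrite -ler_sqr ?nnegrE// expr1n real_normK ?num_real// -e lerDl sqr_ge0.
- by apply: ae_sub zinv => x e t; rewrite (h _ _ (e t)).
have [||b hb] := ergodic_cst scM Phi0 PhiD PhiC mu_inv mu_erg mi.
- apply: ae_sub z1 => x /norm1P e.
  by rewrite -ler_sqr ?nnegrE// expr1n real_normK ?num_real// -e lerDr sqr_ge0.
- by apply: ae_sub zinv => x e t; rewrite (h _ _ (e t)).
exists (a +i* b)%C; apply: ae_sub2 ha hb => x.
by case: (z x) => p q /= -> ->.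
Qed.

End eigen.

(** * Disintegration along the phase *)

Section phase_flow.
Context {R : realType} {M : ptopologicalType}.
Hypothesis scM : @second_countable M.
Variable Phi : R -> M -> M.
Hypothesis Phi0 : forall x, Phi 0 x = x.
Hypothesis PhiD : forall s t x, Phi (s + t) x = Phi s (Phi t x).
Hypothesis PhiC : continuous (fun p : R * M => Phi p.1 p.2).
Variable mu : probability (Borel M) R.
Hypothesis mu_inv : flow_invariant mu Phi.

Local Notation leb := (@lebesgue_measure R).

Lemma measurable_flow_comp d (T : measurableType d) (f : T -> R) (h : T -> Borel M) :
  measurable_fun setT f -> measurable_fun setT h ->
  measurable_fun setT (fun x => Phi (f x) (h x) : Borel M).
Proof.
move=> mf mh.
have mp : measurable_fun setT (fun x => (f x, h x) : measurableTypeR R * Borel M).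
  exact: measurable_fun_pair.
exact: (measurableT_comp (measurable_flow scM PhiC) mp).
Qed.

Lemma ge0_integral_invariant t (f : M -> \bar R) :
  measurable_fun setT (f : Borel M -> \bar R) -> (forall x, 0 <= f x)%E ->
  (\int[mu]_x f (Phi t x) = \int[mu]_x f x)%E.
Proof.
move=> mf f0.
have mt := @measurable_time _ _ _ PhiC t.
have := @ge0_integral_pushforward _ _ _ _ R _ mt mu setT f measurableT mf (fun x _ => f0 x).
rewrite preimage_setT => <-.
by apply: eq_measure_integral => A mA _; exact: mu_inv.
Qed.

Variables (T : R) (beta : M -> R) (G : set (Borel M)).
Hypothesis mbeta : measurable_fun setT (beta : Borel M -> R).
Hypothesis beta01 : forall x, 0 <= beta x < 1.
Hypothesis mG : measurable G.
Hypothesis Ginv : forall t x, G x -> G (Phi t x).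
Hypothesis G1 : mu G = 1%E.
Hypothesis betaG : forall x u, G x ->
  exists k : int, beta (Phi (u * T) x) = beta x + u + k%:~R.

(** Flows [x] back to phase 0. *)
Definition to_section (x : M) : M := Phi (- beta x * T) x.

Lemma measurable_to_section : measurable_fun setT (to_section : Borel M -> Borel M).
Proof.
apply: measurable_flow_comp => //.
by apply: measurable_funM => //; exact: measurableT_comp.
Qed.

Definition section_measure : probability (Borel M) R :=
  image_probability mu measurable_to_section.

Lemma section_measureE (B : set (Borel M)) :
  section_measure B = mu (to_section @^-1` B).
Proof. by []. Qed.

Lemma int_itv01 (k : int) (a b : R) : 0 <= a < 1 -> 0 <= b < 1 ->
  a = b + k%:~R -> k = 0.
Proof.
move=> /andP[a0 a1] /andP[b0 b1] e.
have h1 : (-1)%:~R < k%:~R :> R by rewrite mulrN1z; lra.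
have h2 : k%:~R < 1%:~R :> R by rewrite mulr1z; lra.
move: h1 h2; rewrite !ltr_int; lia.
Qed.

Lemma beta_to_section x : G x -> beta (to_section x) = 0.
Proof.
move=> Gx; have [k e] := betaG (- beta x) Gx.
have e' : beta (to_section x) = 0 + k%:~R by rewrite /to_section e; ring.
have k0 : k = 0 by apply: int_itv01 e' => //; rewrite lexx ltr01.
by rewrite e' k0 addr0.
Qed.

Lemma to_sectionK x : Phi (beta x * T) (to_section x) = x.
Proof. by rewrite /to_section -PhiD mulNr subrr Phi0. Qed.

Lemma to_section_flow x u : G x ->
  exists k : int, beta (Phi (u * T) x) = beta x + u + k%:~R /\
    to_section (Phi (u * T) x) = Phi (- k%:~R * T) (to_section x).
Proof.
move=> Gx; have [k e] := betaG u Gx; exists k; split=> //.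
rewrite /to_section e -!PhiD; congr Phi; ring.
Qed.

Lemma to_section_period x (k : int) : G x ->
  to_section (Phi (k%:~R * T) x) = Phi (k%:~R * T) (to_section x).
Proof.
move=> Gx; have [j [e ->]] := to_section_flow k%:~R Gx.
have : beta (Phi (k%:~R * T) x) = beta x + (k + j)%:~R by rewrite e intrD addrA.
by move=> /(int_itv01 (beta01 _) (beta01 _)) /eqP; rewrite addr_eq0 => /eqP ->;
  rewrite mulrNz.
Qed.

Lemma section_flow y s : G y -> beta y = 0 -> 0 <= s < 1 ->
  beta (Phi (s * T) y) = s /\ to_section (Phi (s * T) y) = y.
Proof.
move=> Gy y0 s01; have [j [e]] := to_section_flow s Gy.
have : beta (Phi (s * T) y) = s + j%:~R by rewrite e y0 add0r.
move=> /(int_itv01 (beta01 _) s01) j0; rewrite {}e j0 y0 => ->.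
rewrite add0r addr0 mulNr mul0r oppr0 Phi0; split=> //.
by rewrite /to_section y0 oppr0 mul0r Phi0.
Qed.

Lemma muG_ae : {ae mu, forall x, G x}.
Proof. exact: full_ae. Qed.

(** [to_section] commutes with the return map on [G], and [mu] is invariant. *)
Lemma section_measure_period (k : int) (B : set (Borel M)) : measurable B ->
  section_measure (Phi (k%:~R * T) @^-1` B) = section_measure B.
Proof.
move=> mB.
have mBk := measurable_time_preimage PhiC (k%:~R * T) mB.
have mp (C : set (Borel M)) : measurable C -> measurable (to_section @^-1` C : set (Borel M)).
  by move=> mC; rewrite -[X in measurable X]setTI; exact: measurable_to_section.
rewrite (section_measureE B) (section_measureE (Phi (k%:~R * T) @^-1` B)).
rewrite -[RHS](mu_inv (k%:~R * T)); last exact: mp.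
have GG (C D : set (Borel M)) : measurable C -> measurable D ->
    (forall x, G x -> C x -> D x) -> (mu C <= mu D)%E.
  move=> mC mD CD; rewrite -[leRHS]adde0.
  have <- : mu (~` G) = 0%E by rewrite probability_setC// G1 subee.
  apply: le_trans (measureU2 _ mD (measurableC mG)).
  apply: le_measure; rewrite ?inE//.
    by apply: measurableU => //; exact: measurableC.
  by move=> x Cx; have [Gx|nGx] := pselect (G x); [left; exact: CD|right].
have m2 := measurable_time_preimage PhiC (k%:~R * T) (mp _ mB).
apply/eqP; rewrite eq_le; apply/andP; split; apply: GG => //; try exact: mp.
  by move=> x Gx /=; rewrite to_section_period.
by move=> x Gx /=; rewrite to_section_period.
Qed.

(** The left-hand side is the integral of [f (Phi ((s - beta x) T) x)] over [x] and
    [0 <= s < 1].  Substitute [u = s - beta x], then [y = Phi (u T) x], which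
    preserves [mu].  This leaves [f y] times the length of the set of [u] for which
    the phase of [Phi (- u T) y], plus [u], lies in [0, 1); as the phase is
    [beta y - u] modulo 1, the set is the interval from [beta y - 1] to [beta y]. *)
Lemma section_disintegration (f : M -> R) :
  measurable_fun setT (f : Borel M -> R) -> (forall x, 0 <= f x) ->
  (\int[leb]_(s in `[0%R, 1%R[) \int[section_measure]_y (f (Phi (s * T) y))%:E
     = \int[mu]_x (f x)%:E)%E.
Proof.
move=> mf f0.
pose i01 (s : R) : R := \1_(`[0, 1[%classic : set R) s.
have mi01 : measurable_fun setT i01 by exact: measurable_indic.
have i01_ge0 s : 0 <= i01 s by rewrite /i01 indicE.
pose iG (x : M) : R := \1_G x.
have miG : measurable_fun setT (iG : Borel M -> R) by exact: measurable_indic.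
have iG_ge0 x : 0 <= iG x by rewrite /iG indicE.
(* The factor [iG x] allows the relation for phases, valid on [G], to be used
   everywhere. *)
pose F (s : R) (x : M) : R := i01 s * iG x * f (Phi ((s - beta x) * T) x).
have F0 s x : (0 <= (F s x)%:E)%E by rewrite lee_fin !mulr_ge0.
have mfst := @measurable_fst _ _ (measurableTypeR R) (Borel M).
have msnd := @measurable_snd _ _ (measurableTypeR R) (Borel M).
have mb2 : measurable_fun setT (fun p : measurableTypeR R * Borel M => beta p.2).
  exact: (measurableT_comp mbeta msnd).
have mF : measurable_fun setT (fun p : measurableTypeR R * Borel M => F p.1 p.2).
  apply: measurable_funM.
    apply: measurable_funM; first exact: (measurableT_comp mi01 mfst).
    exact: (measurableT_comp miG msnd).
  apply: (measurableT_comp mf).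
  apply: measurable_flow_comp => //.
  by apply: measurable_funM => //; exact: measurable_funB.
have mtf s : measurable_fun setT (fun y : Borel M => f (Phi s y)).
  exact: (measurableT_comp mf (@measurable_time _ _ _ PhiC s)).
transitivity (\int[leb]_s \int[mu]_x (F s x)%:E)%E.
  rewrite integral_mkcond; apply: eq_integral => s _ /=; rewrite patchE.
  rewrite /F /i01 indicE; case: ifPn => s01; last first.
    by apply/esym/integral0_eq => x _; rewrite !mul0r.
  rewrite /section_measure ge0_integral_image; last 2 first.
  - by apply/measurable_EFinP; exact: mtf.
  - by move=> x; rewrite lee_fin.
  apply: ge0_ae_eq_integral => //.
  - apply/measurable_EFinP; apply: (measurableT_comp (mtf _)).
    exact: measurable_to_section.
  - apply/measurable_EFinP.
    have := measurableT_comp mF (measurable_pair1 (s : measurableTypeR R) (T2 := Borel M)).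
    by rewrite /F /comp /= /i01 indicE s01.
  - by move=> x _; rewrite lee_fin.
  - by move=> x _; rewrite lee_fin !mulr_ge0.
  - apply: ae_sub muG_ae => x Gx _.
    rewrite /iG indicE mem_set// !mul1r /to_section -PhiD.
    by congr (f (Phi _ _))%:E; ring.
transitivity (\int[mu]_x \int[leb]_s (F s x)%:E)%E.
  apply: (fubini_tonelli (m1 := leb) (m2 := mu)
    (fun p : measurableTypeR R * Borel M => (F p.1 p.2)%:E)) => //.
  exact/measurable_EFinP.
transitivity (\int[mu]_x \int[leb]_u (F (u + beta x) x)%:E)%E.
  apply: eq_integral => x _; apply/esym.
  apply: (integral_shift (f := fun s => (F s x)%:E)) => //.
  apply/measurable_EFinP.
  exact: (measurableT_comp mF (measurable_pair2 (x : Borel M) (T1 := measurableTypeR R))).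
pose H (u : R) (x : M) : R := i01 (u + beta x) * iG x * f (Phi (u * T) x).
have HE u x : F (u + beta x) x = H u x by rewrite /F addrK.
have H0 u x : (0 <= (H u x)%:E)%E by rewrite -HE.
have mH : measurable_fun setT (fun p : measurableTypeR R * Borel M => H p.1 p.2).
  apply: measurable_funM.
    apply: measurable_funM; last exact: (measurableT_comp miG msnd).
    by apply: (measurableT_comp mi01); exact: measurable_funD.
  apply: (measurableT_comp mf).
  by apply: measurable_flow_comp => //; exact: measurable_funM.
transitivity (\int[leb]_u \int[mu]_x (H u x)%:E)%E.
  under eq_integral do under eq_integral do rewrite HE.
  apply/esym; apply: (fubini_tonelli (m1 := leb) (m2 := mu)
    (fun p : measurableTypeR R * Borel M => (H p.1 p.2)%:E)) => //.
  exact/measurable_EFinP.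
pose K (u : R) (y : M) : R := i01 (u + beta (Phi (- (u * T)) y)) * iG y * f y.
have K0 u x : (0 <= (K u x)%:E)%E by rewrite lee_fin !mulr_ge0.
have mK : measurable_fun setT (fun p : measurableTypeR R * Borel M => K p.1 p.2).
  apply: measurable_funM; last exact: (measurableT_comp mf msnd).
  apply: measurable_funM; last exact: (measurableT_comp miG msnd).
  apply: (measurableT_comp mi01); apply: measurable_funD => //.
  apply: (measurableT_comp mbeta); apply: measurable_flow_comp => //.
  by apply: measurableT_comp => //; exact: measurable_funM.
transitivity (\int[leb]_u \int[mu]_y (K u y)%:E)%E.
  apply: eq_integral => u _.
  have mKu : measurable_fun setT (fun y : Borel M => (K u y)%:E).
    apply/measurable_EFinP.
    exact: (measurableT_comp mK (measurable_pair1 (u : measurableTypeR R) (T2 := Borel M))).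
  rewrite -[RHS](ge0_integral_invariant (u * T))//.
  apply: eq_integral => x _; rewrite /K /H (PhiK Phi0 PhiD).
  congr (_ * _ * _)%:E; rewrite /iG !indicE; congr (nat_of_bool _)%:R.
  apply/idP/idP => /set_mem h; apply/mem_set; first exact: Ginv.
  by rewrite -(PhiK Phi0 PhiD (u * T) x); exact: Ginv.
transitivity (\int[mu]_y \int[leb]_u (K u y)%:E)%E.
  apply: (fubini_tonelli (m1 := leb) (m2 := mu)
    (fun p : measurableTypeR R * Borel M => (K p.1 p.2)%:E)) => //.
  exact/measurable_EFinP.
apply: ge0_ae_eq_integral => //.
- apply: (measurable_fun_fubini_tonelli_G (m1 := leb)
    (fun p : measurableTypeR R * Borel M => (K p.1 p.2)%:E)) => //.
  exact/measurable_EFinP.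
- exact/measurable_EFinP.
- by move=> x _; exact: integral_ge0.
- by move=> x _; rewrite lee_fin.
apply: ae_sub muG_ae => y Gy _.
transitivity (\int[leb]_u (f y * \1_(`](beta y - 1), (beta y)]%classic : set R) u)%:E)%E.
  apply: eq_integral => u _; rewrite /K /iG indicE mem_set// mulr1 mulrC.
  congr (_ * _)%:E; rewrite /i01 !indicE; congr (nat_of_bool _)%:R.
  have [k e] := betaG (- u) Gy; rewrite mulNr in e.
  have b1 := beta01 y; have b2 := beta01 (Phi (- (u * T)) y).
  apply/idP/idP => /set_mem /=; rewrite in_itv/= => uI; apply/mem_set => /=; rewrite in_itv/=.
    have : u + beta (Phi (- (u * T)) y) = beta y + k%:~R by rewrite e; ring.
    move=> /(int_itv01 uI b1) k0; rewrite k0 addr0 in e.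
    lra.
  have e' : beta (Phi (- (u * T)) y) = (beta y - u) + k%:~R by [].
  have k0 : k = 0 by apply: int_itv01 e' => //; lra.
  by rewrite e k0; lra.
under eq_integral do rewrite EFinM.
rewrite ge0_integralZl//; last 2 first.
- by apply/measurable_EFinP; exact: measurable_indic.
- by rewrite lee_fin.
rewrite integral_indic// setIT /= lebesgue_measure_itv/= lte_fin.
rewrite ltrBlDr ltrDl ltr01 -EFinB -EFinM; congr EFin; ring.
Qed.

End phase_flow.

(** * Uniqueness of the conditional measures *)

Section uniqueness.
Context {R : realType} {M : ptopologicalType}.
Hypothesis scM : @second_countable M.
Hypothesis crM : completely_regular_space M.

Local Notation leb := (@lebesgue_measure R).

Lemma open_measure_cvg (m : {measure set (Borel M) -> \bar R}) (U : set M)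
    (phi : nat -> M -> R) : open U -> (forall n, continuous (phi n)) ->
  (forall n x, 0 <= phi n x) -> (forall x, nondecreasing_seq (phi^~ x)) ->
  (forall x, phi^~ x @ \oo --> (\1_U x : R)) ->
  (\int[m]_x (phi n x)%:E @[n --> \oo] --> m U)%E.
Proof.
move=> oU cphi phi0 phi_nd phi_cvg.
have mU : measurable (U : set (Borel M)) by exact: borel_open.
have -> : m U = (\int[m]_x limn (fun n => (phi n x)%:E))%E.
  rewrite -[LHS](_ : \int[m]_x (\1_U x)%:E = _)%E; last by rewrite integral_indic// setIT.
  apply: eq_integral => x _; apply/esym/cvg_lim => //.
  by apply: cvg_EFin; [exact: nearW|exact: phi_cvg].
apply: cvg_monotone_convergence => //.
- by move=> n; apply/measurable_EFinP; exact: measurable_continuous.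
- by move=> n x _; rewrite lee_fin.
- by move=> x _ a b ab; rewrite lee_fin; exact: phi_nd.
Qed.

(** Open sets are stable under intersection, and their indicator functions are
    increasing limits of continuous functions. *)
Lemma measure_eq_continuous (m1 m2 : {measure set (Borel M) -> \bar R}) :
  (m1 setT < +oo)%E ->
  (forall phi : M -> R, continuous phi -> (forall x, 0 <= phi x <= 1) ->
     (\int[m1]_x (phi x)%:E = \int[m2]_x (phi x)%:E)%E) ->
  forall B : set (Borel M), measurable B -> m1 B = m2 B.
Proof.
move=> m1fin m12 B mB.
apply: (@measure_unique _ R (Borel M) (@open M) (fun=> setT) erefl _ _ _ m1 m2 _ _ B mB) => //.
- by move=> A C oA oC; exact: openI.
- by move=> _; exact: openT.
- by apply/seteqP; split=> // x _; exists 0%N.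
move=> U oU; have [phi [cphi phi01 phi_nd phi_cvg]] := @open_approximation R M scM crM U oU.
have mU : measurable (U : set (Borel M)) by exact: borel_open.
have lim (m : {measure set (Borel M) -> \bar R}) :
    (\int[m]_x (phi n x)%:E @[n --> \oo] --> m U)%E.
  by apply: open_measure_cvg => // n x; case/andP: (phi01 n x).
have := lim m1; rewrite (_ : (fun n => _) = fun n => \int[m2]_x (phi n x)%:E)%E.
  by move=> h; rewrite -(cvg_lim _ h)//; apply/cvg_lim => //; exact: lim.
by apply/funext => n; exact: m12.
Qed.

Lemma bounded01_integrable (P : probability (Borel M) R) (phi : M -> R) :
  continuous phi -> (forall x, 0 <= phi x <= 1) ->
  P.-integrable setT (fun x => (phi x)%:E).
Proof.
move=> cphi phi01; apply: measurable_bounded_integrable => //.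
- exact: le_lt_trans (probability_le1 P measurableT) (ltry 1).
- exact: measurable_continuous.
exists 1; split; first exact: num_real.
move=> r r1 x _; have /andP[h0 h1] := phi01 x.
by rewrite /= ger0_norm// (le_trans h1)// ltW.
Qed.

Lemma Rintegral01 (P : probability (Borel M) R) (phi : M -> R) :
  continuous phi -> (forall x, 0 <= phi x <= 1) ->
  ((\int[P]_x phi x)%R%:E = \int[P]_x (phi x)%:E)%E.
Proof.
move=> cphi phi01; rewrite /Rintegral fineK//.
by apply: integrable_fin_num => //; exact: bounded01_integrable.
Qed.

Section weakly_continuous.
Variable kappa : R -> probability (Borel M) R.
Hypothesis kappaC : forall phi : M -> R, continuous phi ->
  continuous (fun theta => \int[kappa theta]_x phi x).

(** Dynkin's lemma: for open [U], [kappa theta U] is a limit of continuous functions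
    of [theta]. *)
Lemma measurable_weakly_continuous (B : set (Borel M)) : measurable B ->
  measurable_fun setT (fun theta : measurableTypeR R => kappa theta B).
Proof.
suff h : <<s @open M >> `<=` [set B | measurable (B : set (Borel M)) /\
       measurable_fun setT (fun theta : measurableTypeR R => kappa theta B)].
  by move=> mB; have [] := h B mB.
apply: lambda_system_subset => //.
- by move=> A C oA oC; exact: openI.
- apply/dynkin_lambda_system; split.
  + split; first exact: measurableT.
    by under eq_fun do rewrite probability_setT; exact: measurable_cst.
  + move=> C [mC mkC]; split; first exact: measurableC.
    under eq_fun do rewrite probability_setC//.
    by apply: emeasurable_funB => //; exact: measurable_cst.
  + move=> F tF mF; split; first by apply: bigcupT_measurable => k; have [] := mF k.
    under eq_fun => theta.
      rewrite measure_bigcup//; last by move=> k _; have [] := mF k.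
      over.
    apply: ge0_emeasurable_sum => //.
    by move=> k _; have [] := mF k.
- move=> U oU; split; first exact: borel_open.
  have [phi [cphi phi01 phi_nd phi_cvg]] := @open_approximation R M scM crM U oU.
  have mU : measurable (U : set (Borel M)) by exact: borel_open.
  apply: (emeasurable_fun_cvg (fun n theta => (\int[kappa theta]_x phi n x)%R%:E)).
  + move=> n; apply/measurable_EFinP; apply: continuous_measurable_fun.
    exact: kappaC.
  + move=> theta _.
    rewrite (_ : (fun n => _) = (fun n => \int[kappa theta]_x (phi n x)%:E)%E); last first.
      by apply/funext => n; rewrite Rintegral01.
    by apply: open_measure_cvg => // n x; case/andP: (phi01 n x).
Qed.

Variable mu : probability (Borel M) R.
Hypothesis kappa_mu : forall phi : M -> R, continuous phi ->
  \int[mu]_x phi x = (2 * pi)^-1 *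
    \int[lebesgue_measure]_(theta in `[0, 2 * pi]) (\int[kappa theta]_x phi x).

(** The right-hand side integrates [f] for the mixture of the [kappa theta] with
    uniformly distributed [theta], and that mixture agrees with [mu] on continuous
    functions. *)
Lemma borel_disintegration (f : M -> R) : measurable_fun setT (f : Borel M -> R) ->
  (forall x, 0 <= f x) ->
  (\int[mu]_x (f x)%:E = (2 * pi)^-1%:E *
     \int[leb]_(theta in `[0%R, (2 * pi)%R]) \int[kappa theta]_x (f x)%:E)%E.
Proof.
have pi2 : 0 < 2 * pi :> R by rewrite mulr_gt0 ?pi_gt0.
pose U : giry (measurableTypeR R) R := uniform_prob pi2.
pose k : measurableTypeR R -> giry (Borel M) R := kappa.
have mk : measurable_fun setT k.
  apply: measurable_giry_codensity => // B mB.
  exact: measurable_weakly_continuous.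
have bindE (h : M -> R) : measurable_fun setT (h : Borel M -> R) -> (forall x, 0 <= h x) ->
  (\int[giry_bind U mk]_x (h x)%:E = (2 * pi)^-1%:E *
     \int[leb]_(theta in `[0%R, (2 * pi)%R]) \int[kappa theta]_x (h x)%:E)%E.
  move=> mh h0.
  have := @giry_int_bind _ _ _ _ _ U k mk (fun x => (h x)%:E) _ _.
  rewrite /giry_int => ->//; last exact/measurable_EFinP.
  rewrite /U integral_uniform ?subr0//; last first.
    by move=> x; apply: integral_ge0 => y _; rewrite lee_fin.
  apply: (measurable_fun_integral_kernel (l := kappa)) => //.
  - exact: measurable_weakly_continuous.
  - exact/measurable_EFinP.
move=> mf f0; rewrite -bindE//; apply: eq_measure_integral => A mA _.
apply: measure_eq_continuous => //.
  exact: le_lt_trans (probability_le1 mu measurableT) (ltry 1).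
move=> phi cphi phi01; rewrite bindE; last 2 first.
- exact: measurable_continuous.
- by move=> x; case/andP: (phi01 x).
rewrite -Rintegral01// kappa_mu// EFinM; congr (_ * _)%E.
under [RHS]eq_integral do rewrite -Rintegral01//.
rewrite /Rintegral fineK//.
apply: integrable_fin_num => //.
apply: continuous_compact_integrable; first exact: segment_compact.
by apply: continuous_subspaceT; exact: kappaC.
Qed.

End weakly_continuous.

Section conditional.
Variables (mu : probability (Borel M) R) (X : set M) (z : M -> Cx R).
Hypothesis mX : measurable (X : set (Borel M)).
Hypothesis mz : cmeasurable z.

Lemma measurable_fiber theta : measurable (fiber X z theta : set (Borel M)).
Proof.
apply: measurableI => //; rewrite -[X in measurable X]setCK; apply: measurableC.
apply: (@measurable_neq_complex _ _ (Borel M) z (cst (cis theta))).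
- by [].
- by split; exact: measurable_cst.
Qed.

(** Localises the disintegration formula to small phases: [kappa theta] is carried
    by points of phase [theta / (2 pi)]. *)
Lemma conditional_initial (kappa : R -> probability (Borel M) R) (b : R) (phi : M -> R) :
  conditional_measures mu X z kappa -> 0 < b < 1 ->
  continuous phi -> (forall x, 0 <= phi x <= 1) ->
  (\int[mu]_x (phi x * \1_[set y | phase (z y) < b] x)%:E = (2 * pi)^-1%:E *
     \int[leb]_(theta in `[0%R, (2 * pi * b)%R[) \int[kappa theta]_x (phi x)%:E)%E.
Proof.
move=> [kfib _ kmu kC] /andP[b0 b1] cphi phi01.
have pi2 : 0 < 2 * pi :> R by rewrite mulr_gt0 ?pi_gt0.
have [mr mi] := mz.
have mphase : measurable_fun setT (fun x : Borel M => phase (z x)) by exact: measurable_phase.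
have mS : measurable ([set y | phase (z y) < b] : set (Borel M)).
  rewrite -[X in measurable X]setTI.
  exact: (measurable_fun_ltr mphase (measurable_cst b)).
have mphi := measurable_continuous cphi.
rewrite (borel_disintegration kC kmu); last 2 first.
- by apply: measurable_funM => //; exact: measurable_indic.
- by move=> x; rewrite mulr_ge0 ?indicE//; case/andP: (phi01 x).
congr (_ * _)%E.
have sub : `[0, 2 * pi * b[ `<=` `[0, 2 * pi].
  move=> x /=; rewrite !in_itv/= => /andP[-> h]; rewrite (le_trans (ltW h))//.
  by rewrite ler_piMr// ltW.
have mJ : measurable_fun setT (fun theta : measurableTypeR R =>
    \int[kappa theta]_x (phi x * \1_[set y | phase (z y) < b] x)%:E)%E.
  apply: (measurable_fun_integral_kernel (l := kappa)).
  - exact: measurable_weakly_continuous.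
  - by move=> x; rewrite lee_fin mulr_ge0 ?indicE//; case/andP: (phi01 x).
  - by apply/measurable_EFinP; apply: measurable_funM => //; exact: measurable_indic.
rewrite -integral_itv_bndo_bndc; last exact: measurable_funS mJ.
rewrite [RHS]integral_mkcond [LHS]integral_mkcond; apply: eq_integral => theta _.
rewrite !patchE.
have [th|nth] := boolP (theta \in (`[0, 2 * pi[%classic : set R)); last first.
  case: ifPn => // /set_mem /=; rewrite in_itv/= => /andP[h1 h2].
  move: nth; rewrite notin_setE /= in_itv/= h1/= => /negP; rewrite -leNgt => h3.
  exfalso; nra.
move: (th); rewrite inE/= in_itv/= => /andP[th0 th1].
have fib_ae : {ae kappa theta, forall x, phase (z x) = theta / (2 * pi)}.
  apply: ae_sub (full_ae (measurable_fiber theta) (kfib theta)) => x [_ /= ->].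
  have {1}-> : theta = 2 * pi * (theta / (2 * pi)) by rewrite mulrC divfK ?gt_eqF.
  apply: phase_cis.
  by rewrite (divr_ge0 th0 (ltW pi2))/= ltr_pdivrMr// mul1r.
have [thb|thb] := ltP theta (2 * pi * b).
  rewrite mem_set/=; last by rewrite in_itv/= th0.
  apply: ge0_ae_eq_integral => //.
  - by apply/measurable_EFinP; apply: measurable_funM => //; exact: measurable_indic.
  - exact/measurable_EFinP.
  - by move=> x _; rewrite lee_fin mulr_ge0 ?indicE//; case/andP: (phi01 x).
  - by move=> x _; rewrite lee_fin; case/andP: (phi01 x).
  - apply: ae_sub fib_ae => x xph _; rewrite indicE mem_set ?mulr1//=.
    by rewrite xph ltr_pdivrMr// mulrC.
rewrite memNset/=; last by rewrite in_itv/= th0/= ltNge thb.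
rewrite -[RHS](integral0 (kappa theta) setT).
apply: ge0_ae_eq_integral => //.
- by apply/measurable_EFinP; apply: measurable_funM => //; exact: measurable_indic.
- by move=> x _; rewrite lee_fin mulr_ge0 ?indicE//; case/andP: (phi01 x).
- apply: ae_sub fib_ae => x xph _; rewrite indicE memNset ?mulr0//=.
  by rewrite xph ltr_pdivrMr// mulrC => /(le_lt_trans thb); rewrite ltxx.
Qed.

(** If the integrals of [phi] at [theta = 0] differed, weak continuity would keep
    them apart on some interval [0 <= theta < 2 pi b], against [conditional_initial]. *)
Lemma conditional_unique (k1 k2 : R -> probability (Borel M) R) :
  conditional_measures mu X z k1 -> conditional_measures mu X z k2 ->
  forall B : set (Borel M), measurable B -> k1 0 B = k2 0 B.
Proof.
move=> c1 c2; apply: measure_eq_continuous.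
  exact: le_lt_trans (probability_le1 (k1 0) measurableT) (ltry 1).
suff le k k' : conditional_measures mu X z k -> conditional_measures mu X z k' ->
    forall phi : M -> R, continuous phi -> (forall x, 0 <= phi x <= 1) ->
    \int[k 0]_x phi x <= \int[k' 0]_x phi x.
  move=> phi cphi phi01; rewrite -!Rintegral01//; congr EFin.
  by apply/eqP; rewrite eq_le !le.
move=> ck ck' phi cphi phi01; rewrite leNgt; apply/negP => lt.
have pi2 : 0 < 2 * pi :> R by rewrite mulr_gt0 ?pi_gt0.
pose g theta := \int[k theta]_x phi x; pose g' theta := \int[k' theta]_x phi x.
have cg : continuous g by case: ck => _ _ _; exact.
have cg' : continuous g' by case: ck' => _ _ _; exact.
(* A third of the gap on either side leaves the two ranges apart. *)
have [e e0 e_lt] : exists2 e : R, 0 < e & g' 0 + e < g 0 - e.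
  exists ((g 0 - g' 0) / 3); rewrite /g /g'; lra.
have : \forall theta \near (0 : R), g' theta < g' 0 + e /\ g 0 - e < g theta.
  near=> theta; split.
    by near: theta; apply: (cvgr_lt (g' 0)); [exact: cg'|rewrite ltrDl].
  by near: theta; apply: (cvgr_gt (g 0)); [exact: cg|rewrite ltrBlDr ltrDl].
move=> /nbhs_ballP[r /= r0 rP].
(* [theta < 2 pi b] implies [theta < r]; the bound 1/2 serves [conditional_initial],
   which needs [b < 1]. *)
pose b := Num.min (r / (2 * pi)) 2^-1.
have b01 : 0 < b < 1.
  rewrite lt_min divr_gt0//= invr_gt0 ltr0n/= gt_min; apply/orP; right.
  by rewrite invf_lt1// ltr1n.
have /andP[b0 b1] := b01.
have br : 2 * pi * b <= r.
  by rewrite mulrC -ler_pdivlMr// ge_min lexx.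
have := conditional_initial ck b01 cphi phi01.
rewrite (conditional_initial ck' b01 cphi phi01) => /(congr1 (fun x => (2 * pi)%:E * x)%E).
rewrite !muleA -!EFinM divff ?gt_eqF// !mul1e.
under eq_integral do rewrite -Rintegral01//.
under [RHS]eq_integral do rewrite -Rintegral01//.
rewrite -/(g _) -/(g' _) => eqI.
have I0b theta : `[0, 2 * pi * b[%classic theta -> g' theta <= g' 0 + e /\ g 0 - e <= g theta.
  rewrite /= in_itv/= => /andP[t0 tb].
  have : ball (0 : R) r theta.
    by rewrite /ball/= sub0r normrN ger0_norm// (lt_le_trans tb).
  by move=> /rP[/ltW h1 /ltW h2].
have mitv : measurable (`[0, 2 * pi * b[%classic : set (measurableTypeR R)) by [].
have lebI : leb `[0, 2 * pi * b[%classic = (2 * pi * b)%:E.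
  by rewrite lebesgue_measure_itv/= lte_fin mulr_gt0// oppr0 adde0.
have mg : measurable_fun setT g by exact: continuous_measurable_fun.
have mg' : measurable_fun setT g' by exact: continuous_measurable_fun.
have pos P : 0 <= \int[P : probability (Borel M) R]_x phi x.
  by apply: Rintegral_ge0 => x _; case/andP: (phi01 x).
have h1 : (\int[leb]_(theta in `[0%R, (2 * pi * b)%R[) (g' theta)%:E <= (g' 0 + e)%:E * (2 * pi * b)%:E)%E.
  rewrite -lebI -integral_cst//; apply: ge0_le_integral => //.
  - by move=> theta _; rewrite lee_fin pos.
  - by apply/measurable_EFinP; exact: measurable_funS mg'.
  - by move=> theta /I0b[]; rewrite lee_fin.
have h2 : ((g 0 - e)%:E * (2 * pi * b)%:E <= \int[leb]_(theta in `[0%R, (2 * pi * b)%R[) (g theta)%:E)%E.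
  rewrite -lebI -integral_cst//; apply: ge0_le_integral => //.
  - move=> theta _; rewrite lee_fin; have := pos (k' 0); rewrite -/(g' 0); lra.
  - by apply/measurable_EFinP; exact: measurable_funS mg.
  - by move=> theta /I0b[]; rewrite lee_fin.
have := le_trans h2 (le_trans _ h1); rewrite {}eqI => /(_ (lexx _)).
rewrite -!EFinM lee_fin leNgt ltr_pM2r ?e_lt// mulr_gt0//.
Unshelve. all: by end_near. Qed.

End conditional.
End uniqueness.

(** * The suspension of a flow *)

Section suspension_flow.
Context {R : realType} {M : topologicalType}.
Variable Phi : R -> M -> M.
Hypothesis Phi0 : forall x, Phi 0 x = x.
Hypothesis PhiD : forall s t x, Phi (s + t) x = Phi s (Phi t x).
Hypothesis PhiC : continuous (fun p : R * M => Phi p.1 p.2).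
Variable T : R.
Let Psi (p : M * R) : M := Phi (p.2 * T) p.1.

Lemma iterz_flow (k : int) x : iterz (Phi T) (Phi (- T)) k x = Phi (k%:~R * T) x.
Proof.
case: k => n /=.
  elim: n => [|n IH] /=; first by rewrite mul0r Phi0.
  by rewrite IH -PhiD; congr Phi; rewrite -!pmulrn -[n.+1]addn1 natrD; ring.
have -> : (Negz n)%:~R * T = n.+1%:R * (- T) by rewrite NegzE mulrNz mulNr mulrN.
elim: n => [|n IH] /=; first by rewrite mul1r.
by rewrite IH -PhiD; congr Phi; rewrite -[n.+2]addn1 natrD; ring.
Qed.

Lemma suspension_proj_flow p :
  Psi (suspension_proj (Phi T) (Phi (- T)) p) = Psi p.
Proof.
by rewrite /suspension_proj /Psi /= iterz_flow -PhiD; congr Phi; ring.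
Qed.

Lemma suspension_flow_conj t p :
  Psi (suspension_flow (Phi T) (Phi (- T)) t p) = Phi (t * T) (Psi p).
Proof.
by rewrite /suspension_flow suspension_proj_flow /Psi /= -PhiD; congr Phi; ring.
Qed.

Lemma eigen_period (zetat : M -> Cx R) a y :
  (forall k : int, zetat (Phi T (Phi (k%:~R * T) y)) =
     cis a * zetat (Phi (k%:~R * T) y)) ->
  forall k : int, zetat (Phi (k%:~R * T) y) = cis (a * k%:~R) * zetat y.
Proof.
move=> eig.
have step (j : int) : zetat (Phi ((j + 1)%:~R * T) y) =
    cis a * zetat (Phi (j%:~R * T) y).
  by rewrite -eig -PhiD; congr (zetat (Phi _ y)); rewrite intrD; ring.
elim/int_rect => [|n IH|n IH].
- by rewrite mul0r Phi0 mulr0 cis0 mul1r.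
- rewrite -addn1 PoszD step IH mulrA -cisD; congr (cis _ * _).
  by rewrite intrD; ring.
- have := step (- n.+1%:Z); rewrite (_ : - n.+1%:Z + 1 = - n%:Z); last by lia.
  rewrite IH => e; apply: (mulfI (cis_neq0 a)).
  rewrite -e mulrA -cisD; congr (cis _ * _).
  by rewrite -[n.+1]addn1 PoszD opprD intrD; ring.
Qed.

(** Over one period the values are prescribed; the eigenvalue equation of the return
    map is what makes consecutive periods fit together. *)
Lemma eigen_extension (zeta zetat : M -> Cx R) a y :
  (forall k : int, zetat (Phi T (Phi (k%:~R * T) y)) =
     cis a * zetat (Phi (k%:~R * T) y)) ->
  (forall (k : int) (s : R), 0 <= s < 1 ->
     zeta (Phi (s * T) (Phi (k%:~R * T) y)) =
     cis (a * s) * zetat (Phi (k%:~R * T) y)) ->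
  forall u, zeta (Phi (u * T) y) = cis (a * u) * zetat y.
Proof.
move=> eig ext u; have /andP[h1 h2] := real_floor_itv (num_real u).
have u01 : 0 <= u - (Num.floor u)%:~R < 1.
  by rewrite subr_ge0 h1/= ltrBlDl -[X in _ + X]/(1%:~R) -intrD.
rewrite {1}(_ : u * T = (u - (Num.floor u)%:~R) * T + (Num.floor u)%:~R * T).
  by rewrite PhiD ext// (eigen_period eig) mulrA -cisD; congr (cis _ * _); ring.
by ring.
Qed.

Lemma suspension_proj_space (Y : set M) (p : M * R) :
  (forall (k : int) y, Y y -> Y (Phi (k%:~R * T) y)) ->
  Y p.1 -> suspension_space Y (suspension_proj (Phi T) (Phi (- T)) p).
Proof.
move=> Yinv Yp; split; rewrite /suspension_proj /= ?iterz_flow; first exact: Yinv.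
have /andP[h1 h2] := real_floor_itv (num_real p.2).
by rewrite in_itv/= subr_ge0 h1/= ltrBlDl -[X in _ + X]/(1%:~R) -intrD.
Qed.

(** [Psi] is defined and continuous on the whole of [M * R], and constant on the
    equivalence classes. *)
Lemma suspension_continuous_flow (Y : set M) :
  (forall (k : int) y, Y y -> Y (Phi (k%:~R * T) y)) ->
  suspension_continuous (Phi T) (Phi (- T)) Y Psi.
Proof.
move=> Yinv U oU; split; first by move=> p [].
exists (Psi @^-1` U); split.
  have cPsi : continuous Psi.
    move=> p; apply: (@continuous_comp _ _ _ (fun p : M * R => (p.2 * T, p.1))
      (fun p : R * M => Phi p.1 p.2)); last exact: PhiC.
    move=> W [[P Q] /= [Pt Qx] PQW].
    have := @mulrr_continuous R T p.2 P Pt => nP.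
    exists (Q, [set s | P (s * T)]) => [//|q [/= q1 q2]].
    exact: PQW.
  by move/continuousP : cPsi; exact.
move=> p Yp; have e := suspension_proj_flow p; split=> [[_ /=]|h].
  by rewrite e.
by split; [exact: suspension_proj_space|rewrite /= e].
Qed.

End suspension_flow.

(** * Existence of the conditional measures *)

Section existence.
Context {R : realType} {M : ptopologicalType}.
Hypothesis scM : @second_countable M.
Variable Phi : R -> M -> M.
Hypothesis Phi0 : forall x, Phi 0 x = x.
Hypothesis PhiD : forall s t x, Phi (s + t) x = Phi s (Phi t x).
Hypothesis PhiC : continuous (fun p : R * M => Phi p.1 p.2).
Variable mu : probability (Borel M) R.
Hypothesis mu_inv : flow_invariant mu Phi.
Hypothesis X_compact : compact (msupport mu).
Variables (z : M -> Cx R) (omega : R).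
Hypothesis omega0 : omega != 0.
Hypothesis mz : cmeasurable z.

Local Notation leb := (@lebesgue_measure R).
Local Notation X := (msupport mu).
Local Notation T := (2 * pi / omega).
Local Notation beta := (fun x => phase (z x)).

Lemma frequency_period : omega * T = 2 * pi.
Proof. by rewrite mulrC divfK. Qed.

(** A strictly invariant set, but the quantifier over all times may take it out of
    the Borel sets. *)
Definition good_point : set M := [set x | [/\ X x, `|z x| = 1 &
  forall t, z (Phi t x) = cis (omega * t) * z x]].

Lemma good_point_invariant t x : good_point x -> good_point (Phi t x).
Proof.
move=> [Xx zx zrel]; split.
- by apply: (msupport_invariant PhiC mu_inv).
- by rewrite zrel normrM norm_cis mul1r.
- by move=> s; rewrite -PhiD !zrel mulrDr cisD mulrA.
Qed.

Lemma good_set_exists : {ae mu, forall x, `|z x| = 1} ->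
  {ae mu, forall x, forall t, z (Phi t x) = cis (omega * t) * z x} ->
  exists G : set (Borel M), [/\ measurable G, G `<=` good_point,
    forall t x, G x -> G (Phi t x) & mu G = 1%E].
Proof.
move=> z1 zrel; apply: (invariant_borel_core scM Phi0 PhiD PhiC mu_inv).
  exact: good_point_invariant.
have mX := measurable_msupport mu.
have aeX : {ae mu, forall x, X x} by exact: (full_ae mX (msupport_full scM mu)).
have aeZ : {ae mu, forall x, `|z x| = 1 /\ forall t, z (Phi t x) = cis (omega * t) * z x}.
  exact: ae_sub2 (fun x => @conj _ _) z1 zrel.
by apply: ae_sub2 aeX aeZ => x Xx [].
Qed.

Variable G : set (Borel M).
Hypothesis mG : measurable G.
Hypothesis Ggood : G `<=` good_point.
Hypothesis Ginv : forall t x, G x -> G (Phi t x).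
Hypothesis G1 : mu G = 1%E.

Lemma measurable_eigenphase : measurable_fun setT (beta : Borel M -> R).
Proof. by case: mz => mr mi; exact: measurable_phase. Qed.

Lemma eigenphase_itv x : 0 <= beta x < 1.
Proof. exact: phase_itv. Qed.

Lemma eigenphaseP x : G x -> z x = cis (2 * pi * beta x).
Proof. by move=> /Ggood[_ zx _]; rewrite phaseP. Qed.

Lemma eigenphase_flow x u : G x -> exists k : int, beta (Phi (u * T) x) = beta x + u + k%:~R.
Proof.
move=> Gx; apply: cis_2pi_int_diff.
have [_ _ zrel] := Ggood Gx.
rewrite -eigenphaseP; last exact: Ginv.
rewrite zrel {1}(eigenphaseP Gx) -cisD; congr cis.
by rewrite mulrCA frequency_period; ring.
Qed.

Lemma eigenphase0 x : G x -> (beta x = 0 <-> z x = 1).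
Proof.
move=> Gx; split=> [b0|z1]; first by rewrite eigenphaseP// b0 mulr0 cis0.
have -> : z x = cis (2 * pi * 0) by rewrite mulr0 cis0.
by rewrite phase_cis// lexx ltr01.
Qed.

Let nu := section_measure scM PhiC mu T measurable_eigenphase.
Let p0 := to_section Phi T beta.

Lemma to_section_good x : G x -> G (p0 x).
Proof. exact: Ginv. Qed.

Lemma eigen_to_section x : G x -> z (p0 x) = 1.
Proof.
move=> Gx; apply/eigenphase0; first exact: to_section_good.
exact: (beta_to_section eigenphase_itv eigenphase_flow Gx).
Qed.

Lemma ae_good_section : {ae nu, forall y, G y /\ z y = 1}.
Proof.
have mz1 : measurable ([set y | z y = 1] : set (Borel M)).
  rewrite -[X in measurable X]setCK; apply: measurableC.
  apply: (@measurable_neq_complex _ _ (Borel M) z (cst 1)); first exact: mz.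
  by split; exact: measurable_cst.
have mGz : measurable (G `&` [set y | z y = 1]) by exact: measurableI.
apply: (full_ae mGz).
apply/eqP; rewrite eq_le probability_le1//= -G1 (section_measureE scM PhiC mu T measurable_eigenphase).
apply: le_measure; rewrite ?inE//.
  have mp := @measurable_to_section R M scM Phi PhiC T beta measurable_eigenphase.
  by have := mp measurableT _ mGz; rewrite setTI.
by move=> x Gx; split; [exact: to_section_good|exact: eigen_to_section].
Qed.

(** The conditional measure on the fibre over [theta] is that on the fibre over 0,
    carried along the flow for the time in which [z] turns by [theta]. *)
Definition phase_measure (theta : R) : probability (Borel M) R :=
  image_probability nu (@measurable_time _ _ _ PhiC (theta / omega)).

Lemma phase_measureE theta (B : set (Borel M)) :
  phase_measure theta B = nu (Phi (theta / omega) @^-1` B).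
Proof. by []. Qed.

Lemma phase_measure_fiber theta : phase_measure theta (fiber X z theta) = 1%E.
Proof.
have mX := measurable_msupport mu.
have mF := measurable_fiber mX mz theta.
have mF' := measurable_time_preimage PhiC (theta / omega) mF.
rewrite phase_measureE; apply/eqP; rewrite eq_le probability_le1//=.
have [B mB [BP <-]] := ae_full_subset ae_good_section.
apply: le_measure; rewrite ?inE// => y /BP[Gy zy].
have [Xy _ zrel] := Ggood Gy; split.
  by apply: (msupport_invariant PhiC mu_inv).
by rewrite /= zrel zy mulr1 mulrC divfK.
Qed.

Lemma phase_measure_period theta (B : set (Borel M)) : measurable B ->
  phase_measure (theta + 2 * pi) B = phase_measure theta B.
Proof.
move=> mB; rewrite !phase_measureE.
have mB' := measurable_time_preimage PhiC (theta / omega) mB.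
rewrite -[RHS](section_measure_period scM PhiD PhiC mu_inv measurable_eigenphase eigenphase_itv mG G1 eigenphase_flow 1 mB').
congr (nu _); apply/seteqP.
have e y : Phi ((theta + 2 * pi) / omega) y = Phi (theta / omega) (Phi (1%:~R * T) y).
  by rewrite -PhiD; congr Phi; rewrite mulr1z mul1r mulrDl.
by split=> y; rewrite /= e.
Qed.

Definition phase_mean (phi : M -> R) (theta : R) : R :=
  \int[phase_measure theta]_x phi x.

Section unit_interval.
Variable phi : M -> R.
Hypothesis cphi : continuous phi.
Hypothesis phi01 : forall x, 0 <= phi x <= 1.

Lemma phase_mean01E theta :
  ((phase_mean phi theta)%:E = \int[nu]_y (phi (Phi (theta / omega) y))%:E)%E.
Proof.
rewrite /phase_mean Rintegral01// /phase_measure ge0_integral_image//.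
  by apply/measurable_EFinP; exact: measurable_continuous.
by move=> x; rewrite lee_fin; case/andP: (phi01 x).
Qed.

(** Continuity along orbits and dominated convergence. *)
Lemma phase_mean01_continuous : continuous (phase_mean phi).
Proof.
have E : phase_mean phi = fun theta => \int[nu]_y phi (Phi (theta / omega) y).
  by apply/funext => theta; rewrite [RHS]/Rintegral -phase_mean01E.
rewrite E => theta.
have cf y : continuous (fun th : R => phi (Phi (th / omega) y)).
  move=> th; apply: (@continuous_comp _ _ _ (fun th : R => Phi (th / omega) y) phi); last exact: cphi.
  apply: (@continuous_comp _ _ _ (fun th : R => (th / omega, y)) (fun p : R * M => Phi p.1 p.2)); last exact: PhiC.
  move=> U [[P Q] /= [Pt Qx] PQU].
  have h := @mulrr_continuous R omega^-1 th P Pt.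
  apply: filterS (h : nbhs th _) => s Ps; apply: PQU.
  by split=> //; exact: nbhs_singleton.
have cphit th : continuous (fun y => phi (Phi (th / omega) y)).
  move=> y; apply: (@continuous_comp _ _ _ (Phi (th / omega)) phi); last exact: cphi.
  exact: continuous_time.
have := @continuity_under_integral R _ (Borel M) nu (fun th y => phi (Phi (th / omega) y))
  setT measurableT (theta - 1) (theta + 1) _ _ (cst 1) _ _ theta.
apply.
- by move=> th _; exact: bounded01_integrable.
- by apply: aeW => y _ th _; exact: cf.
- by apply: (bounded01_integrable nu) => [|x]; [exact: cst_continuous|rewrite ler01 lexx].
- by move=> th _; apply: aeW => y _; have /andP[h0 h1] := phi01 (Phi (th / omega) y); rewrite ger0_norm.
- by rewrite inE /= in_itv/= ltrBlDr ltrDl ltr01.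
Qed.

(** [section_disintegration] with [theta = 2 pi s]. *)
Lemma phase_mean01_disintegration :
  \int[mu]_x phi x = (2 * pi)^-1 * \int[leb]_(theta in `[0, 2 * pi]) (phase_mean phi theta).
Proof.
have pi2 : 0 < 2 * pi :> R by rewrite mulr_gt0 ?pi_gt0.
have mphi := measurable_continuous cphi.
have phi0 x : 0 <= phi x by case/andP: (phi01 x).
have mg : measurable_fun setT (phase_mean phi).
  by apply: continuous_measurable_fun; exact: phase_mean01_continuous.
have g0 theta : 0 <= phase_mean phi theta by apply: Rintegral_ge0.
pose h (theta : R) : \bar R := (phase_mean phi theta * \1_(`[0, 2 * pi[%classic : set R) theta)%:E.
have mh : measurable_fun setT h.
  by apply/measurable_EFinP; apply: measurable_funM => //; exact: measurable_indic.
have h0 theta : (0 <= h theta)%E by rewrite lee_fin mulr_ge0// indicE.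
have := section_disintegration scM Phi0 PhiD PhiC mu_inv measurable_eigenphase eigenphase_itv mG Ginv G1 eigenphase_flow mphi phi0.
rewrite (_ : (\int[leb]_(s in _) _)%E = \int[leb]_s h (2 * pi * s)%R)%E; last first.
  rewrite integral_mkcond; apply: eq_integral => s _; rewrite patchE /h indicE.
  have -> : (2 * pi * s \in (`[0, 2 * pi[%classic : set R)) = (s \in (`[0, 1[%classic : set R)).
    apply/idP/idP => /set_mem /=; rewrite in_itv/= => sI; apply/mem_set => /=; rewrite in_itv/=; move: sI.
      by rewrite pmulr_rge0// gtr_pMr.
    by rewrite pmulr_rge0// gtr_pMr.
  case: ifPn => _; last by rewrite mulr0.
  rewrite mulr1 phase_mean01E; apply: eq_integral => y _; congr (phi (Phi _ y))%:E.
  have comm (p q r : R) : p * (q / r) = q * p / r by ring.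
  exact: comm.
move=> e1; have := integral_scale pi2 mh h0; rewrite e1.
rewrite -Rintegral01// (_ : (\int[leb]_x h x)%E =
    (\int[leb]_(theta in `[0%R, (2 * pi)%R]) (phase_mean phi theta)%:E)%E); last first.
  rewrite -integral_itv_bndo_bndc; last by apply/measurable_EFinP; exact: measurable_funS mg.
  rewrite [RHS]integral_mkcond; apply: eq_integral => theta _.
  by rewrite patchE /h indicE; case: ifPn; rewrite ?mulr1 ?mulr0.
move=> e2; rewrite [in RHS]/Rintegral -e2 /= mulKf// gt_eqF//.
Qed.

End unit_interval.

Lemma Rintegral_support (P : probability (Borel M) R) (f g : M -> R) :
  P X = 1%E -> continuous f -> continuous g -> (forall x, X x -> f x = g x) ->
  \int[P]_x f x = \int[P]_x g x.
Proof.
move=> PX cf cg fg.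
have mX := measurable_msupport mu.
rewrite /Rintegral; congr fine; apply: ae_eq_integral => //.
- by apply/measurable_EFinP; exact: measurable_continuous.
- by apply/measurable_EFinP; exact: measurable_continuous.
by apply: ae_sub (full_ae mX PX) => x Xx _; rewrite fg.
Qed.

Lemma phase_measure_support theta : phase_measure theta X = 1%E.
Proof.
have mX := measurable_msupport mu.
apply/eqP; rewrite eq_le probability_le1//= -(phase_measure_fiber theta).
apply: le_measure; rewrite ?inE//; last by move=> x [].
exact: (measurable_fiber mX mz).
Qed.

(** On the compact support a continuous function is an affine image of a
    continuous function into the unit interval.  For the latter all integrals exist
    and may be computed in the extended reals. *)
Lemma support_affine (phi : M -> R) : continuous phi ->
  exists (psi : M -> R) (a b : R), [/\ continuous psi, forall x, 0 <= psi x <= 1 &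
    forall P : probability (Borel M) R, P X = 1%E ->
      \int[P]_x phi x = a * \int[P]_x psi x + b].
Proof.
move=> cphi.
have [C C0 CX] : exists2 C : R, 0 < C & forall x, X x -> `|phi x| <= C.
  have : compact (phi @` X).
    by apply: continuous_compact => //; exact: continuous_subspaceT.
  move=> /compact_bounded[C [_ hC]]; exists (`|C| + 1); first by rewrite ltr_pwDr.
  move=> x Xx; have /= := hC (`|C| + 1); apply; last by exists x.
  by rewrite ltr_pwDr// ler_norm.
(* The formula is the affine map from [-C, C] onto the unit interval, clamped off
   the support so that [psi] is bounded on [M]. *)
pose psi x := Num.max 0 (Num.min 1 ((phi x + C) / (2 * C))).
have cpsi : continuous psi.
  move=> x; apply: (@continuous_max R M (cst 0) (fun x => Num.min 1 ((phi x + C) / (2 * C)))).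
    exact: cst_continuous.
  apply: (@continuous_min R M (cst 1) (fun x => (phi x + C) / (2 * C))).
    exact: cst_continuous.
  apply: (@continuousM R M (fun x => phi x + C) (cst (2 * C)^-1)); last exact: cst_continuous.
  apply: (@continuousD R R^o M phi (cst C)); first exact: cphi.
  exact: cst_continuous.
have psi01 x : 0 <= psi x <= 1.
  by rewrite le_max lexx/= ge_max ler01/= ge_min lexx.
have psiE x : X x -> psi x = (phi x + C) / (2 * C).
  move=> /CX; rewrite ler_norml => /andP[h1 h2].
  have d0 : 0 <= (phi x + C) / (2 * C) by apply: divr_ge0; lra.
  have d1 : (phi x + C) / (2 * C) <= 1 by rewrite ler_pdivrMr ?mul1r; lra.
  by rewrite /psi min_r// max_r.
exists psi, (2 * C), (- C); split=> // P PX.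
rewrite (@Rintegral_support P phi (fun x => 2 * C * psi x + - C))//; last 2 first.
- move=> x; apply: (@continuousD R R^o M (fun x => 2 * C * psi x) (cst (- C))); last exact: cst_continuous.
  apply: (@continuousM R M (cst (2 * C)) psi); first exact: cst_continuous.
  exact: cpsi.
- by move=> x Xx; rewrite psiE// mulrC divfK ?gt_eqF ?mulr_gt0// addrK.
have ipsi := bounded01_integrable P cpsi psi01.
rewrite RintegralD//; last 2 first.
- by apply: (integrableZl (mu := P) measurableT (2 * C) ipsi).
- have := finite_measure_integrable_cst P (- C) measurableT; exact.
rewrite RintegralZl// Rintegral_cst//; congr (_ + _).
rewrite -[RHS]mulr1; congr (_ * _).
exact: (congr1 fine (@probability_setT _ _ _ P)).
Qed.

Lemma phase_conditional : conditional_measures mu X z phase_measure.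
Proof.
have pi2 : 0 < 2 * pi :> R by rewrite mulr_gt0 ?pi_gt0.
have muX : mu X = 1%E by exact: msupport_full.
split.
- exact: phase_measure_fiber.
- by move=> theta B; exact: phase_measure_period.
- move=> phi cphi; have [psi [a [b [cpsi psi01 E]]]] := support_affine cphi.
  rewrite E// phase_mean01_disintegration//.
  under [in RHS]eq_Rintegral do rewrite E ?phase_measure_support//.
  have ig : leb.-integrable `[0, 2 * pi] (EFin \o phase_mean psi).
    apply: continuous_compact_integrable; first exact: segment_compact.
    by apply: continuous_subspaceT; exact: phase_mean01_continuous.
  have ic : leb.-integrable `[0, 2 * pi] (EFin \o cst b).
    apply: continuous_compact_integrable; first exact: segment_compact.
    by apply: continuous_subspaceT; exact: cst_continuous.
  rewrite RintegralD//; last by apply: (integrableZl (mu := leb) _ a ig).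
  have lebI : fine (leb `[0, 2 * pi]%classic) = 2 * pi.
    by rewrite lebesgue_measure_itv/= lte_fin pi2 /= oppr0 addr0.
  rewrite RintegralZl// Rintegral_cst// lebI.
  have lin (I p : R) : p != 0 -> a * (p^-1 * I) + b = p^-1 * (a * I + b * p).
    by move=> pn0; field.
  by apply: lin; rewrite gt_eqF.
- move=> phi cphi; have [psi [a [b [cpsi psi01 E]]]] := support_affine cphi.
  have -> : (fun theta => \int[phase_measure theta]_x phi x) = fun theta => a * phase_mean psi theta + b.
    by apply/funext => theta; rewrite E// phase_measure_support.
  move=> theta; apply: (@continuousD R R^o R (fun theta => a * phase_mean psi theta) (cst b)); last exact: cst_continuous.
  apply: (@continuousM R R (cst a) (phase_mean psi)); first exact: cst_continuous.
  exact: phase_mean01_continuous.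
Qed.

(** * The measurable conjugacy *)

(** The fibre of phase 0 may be null for [mu]; only properties of whole orbits pass
    to it. *)
Lemma ae_invariant_section (P : M -> Prop) : (forall t x, P x -> P (Phi t x)) ->
  {ae mu, forall x, P x} -> {ae nu, forall y, P y}.
Proof.
move=> Pinv aeP.
have [B [mB BP Binv B1]] := invariant_borel_core scM Phi0 PhiD PhiC mu_inv Pinv aeP.
have nuB : nu B = 1%E.
  apply/eqP; rewrite eq_le probability_le1//= -B1 (section_measureE scM PhiC mu T measurable_eigenphase).
  apply: le_measure; rewrite ?inE//.
    have mp := @measurable_to_section R M scM Phi PhiC T beta measurable_eigenphase.
    by have := mp measurableT _ mB; rewrite setTI.
  by move=> x Bx; exact: Binv.
by apply: ae_sub (full_ae mB nuB) => y /BP.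
Qed.

Lemma ae_period (P : M -> Prop) : {ae nu, forall y, P y} ->
  {ae nu, forall y, forall k : int, P (Phi (k%:~R * T) y)}.
Proof.
move=> aeP.
have one (k : int) : {ae nu, forall y, P (Phi (k%:~R * T) y)}.
  move: aeP => [N [mN N0 NP]]; exists (Phi (k%:~R * T) @^-1` N); split.
  - exact: measurable_time_preimage.
  - by rewrite (section_measure_period scM PhiD PhiC mu_inv measurable_eigenphase eigenphase_itv mG G1 eigenphase_flow k mN).
  - by move=> y /= nP; apply: NP.
have h1 : {ae nu, forall y, forall n : nat, P (Phi (n%:Z%:~R * T) y)}.
  by apply: ae_foralln => n; exact: one.
have h2 : {ae nu, forall y, forall n : nat, P (Phi ((Negz n)%:~R * T) y)}.
  by apply: ae_foralln => n; exact: one.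
by apply: ae_sub2 h1 h2 => y a b [n|n]; [exact: a|exact: b].
Qed.

Lemma ae_to_section (P : M -> Prop) : {ae nu, forall y, P y} ->
  {ae mu, forall x, P (p0 x)}.
Proof. exact: ae_image. Qed.

Lemma ae_good : {ae mu, forall x, G x}.
Proof. exact: full_ae. Qed.

Lemma flow_to_section x : Phi (beta x * T) (p0 x) = x.
Proof. exact: (to_sectionK Phi0 PhiD T beta x). Qed.

Lemma ge0_integral_section (f : M -> \bar R) :
  measurable_fun setT (f : Borel M -> \bar R) -> (forall x, 0 <= f x)%E ->
  (\int[nu]_y f y = \int[mu]_x f (p0 x))%E.
Proof. by move=> mf f0; rewrite /nu /section_measure ge0_integral_image. Qed.

Section any_version.
Variable kap : probability (Borel M) R.
Hypothesis kapE : forall B : set (Borel M), measurable B -> kap B = nu B.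

Lemma ae_nu_kap (P : M -> Prop) : {ae nu, forall y, P y} -> {ae kap, forall y, P y}.
Proof. by move=> [N [mN N0 NP]]; exists N; split=> //; rewrite -N0 kapE. Qed.

Lemma ae_kap_nu (P : M -> Prop) : {ae kap, forall y, P y} -> {ae nu, forall y, P y}.
Proof. by move=> [N [mN N0 NP]]; exists N; split=> //; rewrite -N0 kapE. Qed.

Lemma integral_kap (f : M -> \bar R) : (\int[kap]_y f y = \int[nu]_y f y)%E.
Proof. by apply: eq_measure_integral => A mA _; exact: kapE. Qed.

Let L1 := fiber X z 0.
Let Psi (p : M * R) : M := Phi (p.2 * T) p.1.

Lemma good_section_fiber y : G y -> z y = 1 -> L1 y.
Proof. by move=> /Ggood[Xy _ _] zy; split=> //=; rewrite zy cis0. Qed.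

(** By Fubini the product measure of the set is the average over [s] of
    [nu (Phi (s T) @^-1` B)], which [section_disintegration] equates with [mu B]. *)
Lemma product_formula (B : set (Borel M)) : measurable B ->
  (kap \x leb)%E (suspension_space L1 `&` Psi @^-1` B) = mu B.
Proof.
move=> mB.
have mL1 : measurable (L1 : set (Borel M)) := measurable_fiber (measurable_msupport mu) mz 0.
have nuL1 : {ae nu, forall y, L1 y}.
  by apply: ae_sub ae_good_section => y [Gy zy]; exact: good_section_fiber.
set A : set (Borel M * measurableTypeR R) := suspension_space L1 `&` Psi @^-1` B.
have mPsi : measurable_fun setT (Psi : Borel M * measurableTypeR R -> Borel M).
  apply: (measurable_flow_comp scM PhiC) => //.
  by apply: measurable_funM => //; exact: measurable_snd.
have mA : measurable A.
  apply: measurableI; first exact: measurableX.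
  by rewrite -[X in measurable X]setTI; exact: mPsi.
have e1 : (kap \x leb)%E A = (\int[kap]_y leb (xsection A y))%E by [].
rewrite e1 (integral_sections kap leb mA).
have mI : measurable_fun setT (fun y => (\1_B y : R)) by exact: measurable_indic.
have := section_disintegration scM Phi0 PhiD PhiC mu_inv measurable_eigenphase eigenphase_itv mG Ginv G1 eigenphase_flow mI.
rewrite integral_indic// setIT => <-; last by move=> x; rewrite indicE.
rewrite [RHS]integral_mkcond; apply: eq_integral => s _; rewrite patchE.
case: ifPn => s01; last first.
  rewrite (_ : ysection A s = set0) ?measure0//.
  apply/seteqP; split=> // y /ysectionP[[_ /= sI] _].
  by move: s01; rewrite notin_setE; apply.
have mBs := measurable_time_preimage PhiC (s * T) mB.
rewrite (_ : ysection A s = L1 `&` Phi (s * T) @^-1` B); last first.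
  apply/seteqP; split=> y.
    by move=> /ysectionP[[L1y _] By].
  by move=> [L1y By]; apply/ysectionP; split=> //; split=> //; exact: set_mem s01.
transitivity (nu (L1 `&` Phi (s * T) @^-1` B)).
  by apply: kapE; exact: measurableI.
transitivity (\int[nu]_y (\1_(Phi (s * T) @^-1` B) y)%:E)%E; last by [].
rewrite integral_indic// setIT.
apply/eqP; rewrite eq_le; apply/andP; split.
  by apply: le_measure => [||y []//]; rewrite ?inE//; exact: measurableI.
have nL0 : nu (~` L1) = 0%E by apply/negligibleP => //; exact: measurableC.
rewrite -[leRHS]adde0 -nL0.
apply: le_trans (measureU2 _ (measurableI _ _ mL1 mBs) (measurableC mL1)).
apply: le_measure; rewrite ?inE//.
  by apply: measurableU; [exact: measurableI|exact: measurableC].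
by move=> y By; have [L1y|nL1] := pselect (L1 y); [left|right].
Qed.

Let Y : set (Borel M) := G `&` [set y | z y = 1].

Lemma measurable_good_section : measurable Y.
Proof.
apply: measurableI => //.
rewrite -[X in measurable X]setCK; apply: measurableC.
apply: (@measurable_neq_complex _ _ (Borel M) z (cst 1)); first exact: mz.
by split; exact: measurable_cst.
Qed.

Lemma eigen_return y (k : int) : G y -> z (Phi (k%:~R * T) y) = z y.
Proof.
by move=> /Ggood[_ _ ->]; rewrite mulrCA frequency_period (mulrC k%:~R) cis_2pi_int mul1r.
Qed.

Lemma good_section_period (k : int) y : Y y -> Y (Phi (k%:~R * T) y).
Proof. by move=> [Gy zy]; split; [exact: Ginv|rewrite /= eigen_return]. Qed.

Lemma eigenphase_good_section y : Y y -> beta y = 0.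
Proof. by move=> [Gy zy]; apply/eigenphase0. Qed.

Lemma suspension_inverse p : suspension_space Y p ->
  beta (Psi p) = p.2 /\ p0 (Psi p) = p.1.
Proof.
move=> [Yp /=]; rewrite in_itv/= => s01.
exact: (section_flow Phi0 PhiD eigenphase_itv eigenphase_flow (proj1 Yp) (eigenphase_good_section Yp) s01).
Qed.

Lemma suspension_coordinates x : G x -> suspension_space Y (p0 x, beta x).
Proof.
move=> Gx; split=> /=; first by split; [exact: to_section_good|exact: eigen_to_section].
by rewrite in_itv/=; exact: eigenphase_itv.
Qed.

(** On the set [G], [Psi] has the Borel inverse [x |-> (to_section x, beta x)]. *)
Lemma measurable_suspension_image (B : set (Borel M * R)) : measurable B ->
  B `<=` suspension_space Y -> measurable (Psi @` B : set (Borel M)).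
Proof.
move=> mB BY.
pose inv (x : Borel M) : Borel M * measurableTypeR R := (p0 x, beta x).
have minv : measurable_fun setT inv.
  apply: measurable_fun_pair; last exact: measurable_eigenphase.
  exact: (@measurable_to_section R M scM Phi PhiC T beta measurable_eigenphase).
rewrite (_ : Psi @` B = inv @^-1` B).
  by rewrite -[X in measurable X]setTI; exact: minv.
apply/seteqP; split=> [_ [[y s] Bys <-]|x Bx]; last first.
  by exists (inv x) => //; exact: flow_to_section.
have [h1 h2] := suspension_inverse (BY _ Bys).
by rewrite /inv /= h1 h2.
Qed.

(** The witness is the part of the good set of phase 0: [Psi] maps its suspension
    onto the good set. *)
Lemma suspension_essential : exists Y' : set (Borel M),
  [/\ [/\ measurable Y', Y' `<=` L1 & kap Y' = 1%E],
      set_bij Y' Y' (Phi T),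
      [/\ {in suspension_space Y' &, injective Psi},
          Psi @` suspension_space Y' `<=` X,
          mu (Psi @` suspension_space Y') = 1%E &
          forall B : set (Borel M * R), measurable B ->
            B `<=` suspension_space Y' ->
            measurable (Psi @` B : set (Borel M))],
      forall t p, suspension_space Y' p ->
        Psi (suspension_flow (Phi T) (Phi (- T)) t p) = Phi (2 * pi * t / omega) (Psi p) &
      suspension_continuous (Phi T) (Phi (- T)) Y' Psi].
Proof.
have PsiY : Psi @` suspension_space Y = G.
  apply/seteqP; split=> [_ [[y s] [[Gy _] _] <-]|x Gx]; first exact: Ginv.
  by exists (p0 x, beta x); [exact: suspension_coordinates|exact: flow_to_section].
have mY := measurable_good_section.
exists Y; split.
- split; first exact: measurable_good_section.
    by move=> y [Gy zy]; exact: good_section_fiber.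
  rewrite kapE//; apply/eqP; rewrite eq_le probability_le1//=.
  have [B mB [BP <-]] := ae_full_subset ae_good_section.
  by apply: le_measure => [||y /BP //]; rewrite ?inE.
- split.
  + by move=> y /(good_section_period 1); rewrite mul1r.
  + move=> x y _ _ /(congr1 (Phi (- T))).
    by rewrite !(PhiK Phi0 PhiD).
  + move=> y Yy; exists (Phi (- T) y); last exact: (PhiNK Phi0 PhiD).
    by have := good_section_period (-1) Yy; rewrite mulrN1z mulN1r.
- split.
  + move=> [y s] [y' s'] /set_mem Yp /set_mem Yp' e.
    have [h1 h2] := suspension_inverse Yp; have [h1' h2'] := suspension_inverse Yp'.
    by move: h1 h2 h1' h2'; rewrite e /= => -> -> /= <- <-.
  + by rewrite PsiY => x /Ggood[].
  + by rewrite PsiY.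
  + exact: measurable_suspension_image.
- move=> t p _; transitivity (Phi (t * T) (Psi p)).
    exact: (suspension_flow_conj Phi0 PhiD).
  congr Phi.
  by rewrite mulrA; congr (_ / _); rewrite mulrC.
- exact: (suspension_continuous_flow Phi0 PhiD PhiC good_section_period).
Qed.

(** If [zeta] vanishes on [L1] then it vanishes on every orbit through [L1], hence
    almost everywhere, hence on the support by continuity. *)
Lemma restrict_eigen_C (zeta : M -> Cx R) (omega' : R) :
  koopman_eigen_C X Phi omega' zeta ->
  map_eigen_C L1 (Phi T) (cis (2 * pi * omega' / omega)) (fun x => zeta (Psi (x, 0))) /\
  (~ vanishes_on X zeta -> ~ vanishes_on L1 (fun x => zeta (Psi (x, 0)))).
Proof.
move=> [czeta eig].
have -> : (fun x => zeta (Psi (x, 0))) = zeta.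
  by apply/funext => x; rewrite /Psi /= mul0r Phi0.
split; first split.
- by apply: continuous_subspaceW czeta => x [].
- move=> y [Xy _]; rewrite eig//; congr (cis _ * _).
  by rewrite mulrA; congr (_ / _); rewrite mulrC.
move=> + v0; apply; apply: (support_cst scM czeta).
apply: ae_sub ae_good => y Gy _; have [Xp _ _] := Ggood (to_section_good Gy).
rewrite -(flow_to_section y) eig// v0 ?mulr0//.
by apply: good_section_fiber; [exact: to_section_good|exact: eigen_to_section].
Qed.

Lemma sqnorm_cis a (w : Cx R) :
  complex.Re (cis a * w) ^+ 2 + complex.Im (cis a * w) ^+ 2 =
  complex.Re w ^+ 2 + complex.Im w ^+ 2.
Proof.
have := normc_cis a; rewrite /cis; case: w => p q /= h.
rewrite -[RHS]mul1r -h; ring.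
Qed.

Lemma measurable_sqnorm (f : M -> Cx R) : cmeasurable f ->
  measurable_fun setT (fun x : Borel M => ((complex.Re (f x) ^+ 2 + complex.Im (f x) ^+ 2)%:E)).
Proof.
move=> [mr mi]; apply/measurable_EFinP.
by apply: measurable_funD; exact: measurable_funX.
Qed.

Lemma sqnorm_ge0 (w : Cx R) : (0 <= (complex.Re w ^+ 2 + complex.Im w ^+ 2)%:E)%E.
Proof. by rewrite lee_fin addr_ge0 ?sqr_ge0. Qed.

(** The exact relation along orbits passes to [nu] because it is invariant; it makes
    [zeta1 x] and [zeta1 (p0 x)] differ by a factor of modulus 1, so that the norm
    in the space for [nu] equals that for [mu]. *)
Lemma restrict_eigen_L2 (zeta : M -> Cx R) (omega' : R) (zeta1 : M -> Cx R) :
  koopman_eigen_L2 mu Phi omega' zeta -> orbitwise_version mu Phi omega' zeta zeta1 ->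
  map_eigen_L2 kap (Phi T) (cis (2 * pi * omega' / omega)) (fun x => zeta1 (Psi (x, 0))) /\
  (~ vanishes_ae mu zeta -> ~ vanishes_ae kap (fun x => zeta1 (Psi (x, 0)))).
Proof.
move=> [[g [mg zg gfin]] _] [mz1 z1z z1rel].
have -> : (fun x => zeta1 (Psi (x, 0))) = zeta1.
  by apply/funext => x; rewrite /Psi /= mul0r Phi0.
pose P x := forall t, zeta1 (Phi t x) = cis (omega' * t) * zeta1 x.
have Pinv t x : P x -> P (Phi t x).
  by move=> Px s; rewrite -PhiD !Px mulrDr cisD mulrA.
have nuP := ae_invariant_section Pinv z1rel.
have p0P : {ae mu, forall x, zeta1 x = cis (omega' * (beta x * T)) * zeta1 (p0 x)}.
  by apply: ae_sub (ae_to_section nuP) => x Px; rewrite -Px flow_to_section.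
split.
  split.
    exists zeta1; split=> //; first by apply: aeW.
    rewrite integral_kap ge0_integral_section; last 2 first.
    - exact: measurable_sqnorm.
    - by move=> x; exact: sqnorm_ge0.
    have mp := @measurable_to_section R M scM Phi PhiC T beta measurable_eigenphase.
    rewrite (@ge0_ae_eq_integral _ _ _ mu setT _
      (fun x => (complex.Re (g x) ^+ 2 + complex.Im (g x) ^+ 2)%:E))//.
    - exact: (measurableT_comp (measurable_sqnorm mz1) mp).
    - exact: measurable_sqnorm.
    - by move=> x _; exact: sqnorm_ge0.
    - by move=> x _; exact: sqnorm_ge0.
    have h : {ae mu, forall x, zeta1 x = g x} by apply: ae_sub2 z1z zg => x -> ->.
    by apply: ae_sub2 h p0P => x <- -> _; rewrite sqnorm_cis.
  apply: ae_nu_kap; apply: ae_sub nuP => y ->; congr (cis _ * _).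
  by rewrite mulrA; congr (_ / _); rewrite mulrC.
move=> + v0; apply.
have := ae_sub2 _ (ae_to_section (ae_kap_nu v0)) p0P.
move=> /(_ (fun x => zeta1 x = 0)) h0.
apply: ae_sub2 z1z (h0 _) => [x <- //|x h ->].
by rewrite h mulr0.
Qed.

(** The hypotheses hold [nu]-almost everywhere, and [nu] is invariant under the
    return map, so almost every [y] satisfies them at all its returns; then
    [eigen_extension] applies to the orbit of [y]. *)
Lemma extend_eigen_L2 (zetat : M -> Cx R) (omega' : R) (zeta : M -> Cx R) :
  map_eigen_L2 kap (Phi T) (cis (2 * pi * omega' / omega)) zetat ->
  {ae kap, forall y, forall s, 0 <= s < 1 ->
     zeta (Psi (y, s)) = cis (2 * pi * omega' * s / omega) * zetat y} ->
  koopman_eigen_L2 mu Phi omega' zeta /\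
  (~ vanishes_ae kap zetat -> ~ vanishes_ae mu zeta).
Proof.
move=> [[gt [mgt zgt gtfin]] zteig] ztext.
pose A y := [/\ zetat y = gt y, zetat (Phi T y) = cis (2 * pi * omega' / omega) * zetat y &
  forall s, 0 <= s < 1 ->
     zeta (Psi (y, s)) = cis (2 * pi * omega' * s / omega) * zetat y].
have aeA : {ae nu, forall y, A y}.
  have h := ae_sub2 (fun y => @conj _ _) zteig ztext.
  by apply: ae_kap_nu; apply: ae_sub2 zgt h => y h1 [h2 h3].
(* All returns at once: [eigen_extension] uses every period of the orbit. *)
pose Q y := forall k : int, A (Phi (k%:~R * T) y).
have aeQ : {ae mu, forall x, G x /\ Q (p0 x)}.
  exact: ae_sub2 (fun x => @conj _ _) ae_good (ae_to_section (ae_period aeA)).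
have Q0 y : Q y -> A y by move=> /(_ 0); rewrite mul0r Phi0.
have Qext y u : Q y -> zeta (Phi (u * T) y) =
    cis (2 * pi * omega' / omega * u) * zetat y.
  move=> Qy; apply: (eigen_extension Phi0 PhiD) => [k|k s s01].
    by have [] := Qy k.
  by have [_ _ /(_ s s01)] := Qy k; rewrite /Psi /= => ->; congr (cis _ * _); exact: mulrAC.
have ext x : G x -> Q (p0 x) ->
    zeta x = cis (2 * pi * omega' * beta x / omega) * zetat (p0 x).
  move=> Gx Qx; have [_ _ /(_ (beta x) (eigenphase_itv x))] := Q0 _ Qx.
  by rewrite /Psi /= flow_to_section.
pose g x : Cx R := cis (2 * pi * omega' * beta x / omega) * gt (p0 x).
have mp := @measurable_to_section R M scM Phi PhiC T beta measurable_eigenphase.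
split; last first.
  move=> + v0; apply; apply: ae_nu_kap.
  have mne : measurable ([set y | gt y <> 0] : set (Borel M)).
    apply: (@measurable_neq_complex _ _ (Borel M) gt (cst 0)); first exact: mgt.
    by split; exact: measurable_cst.
  have gt0 : {ae nu, forall y, gt y = 0}.
    exists [set y | gt y <> 0]; split=> //.
    rewrite (section_measureE scM PhiC mu T measurable_eigenphase).
    apply/negligibleP; first by have := mp measurableT _ mne; rewrite setTI.
    have : {ae mu, forall x, gt (p0 x) = 0}; last by apply: negligibleS.
    apply: ae_sub2 aeQ v0 => x [Gx Qx]; rewrite ext// => /eqP.
    by rewrite mulf_eq0 (negbTE (cis_neq0 _))/= => /eqP; have [<-] := Q0 _ Qx.
  by apply: ae_sub2 aeA gt0 => y [-> _ _].
split.
  exists g; split.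
  - apply: (@cmeas_mul _ _ (Borel M)).
      apply: cmeas_cis; apply: measurable_funM => //; apply: measurable_funM => //.
      exact: measurable_eigenphase.
    have [mr mi] := mgt.
    by split; [exact: (measurableT_comp mr mp)|exact: (measurableT_comp mi mp)].
  - by apply: ae_sub aeQ => x [Gx Qx]; rewrite ext// /g; have [->] := Q0 _ Qx.
  - under eq_integral do rewrite sqnorm_cis.
    move: gtfin; rewrite integral_kap ge0_integral_section//.
    - exact: measurable_sqnorm.
    - by move=> x; exact: sqnorm_ge0.
move=> t; have T0 : T != 0 by rewrite mulf_neq0 ?invr_eq0// mulf_neq0 ?gt_eqF ?pi_gt0.
apply: ae_sub aeQ => x [Gx Qx].
rewrite -(flow_to_section x) -PhiD.
have tK : t / T * T = t by exact: (divfK T0).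
rewrite (_ : t + _ = (t / T + beta x) * T); last by rewrite (mulrDl (t / T)) tK.
rewrite !Qext// mulrA -cisD; congr (cis _ * _).
have tT : t / T = t * omega / (2 * pi) by rewrite invf_div mulrA.
have pi0 : 2 * pi != 0 :> R by rewrite mulf_neq0 ?gt_eqF ?pi_gt0.
rewrite tT; move: pi0 omega0; move: (2 * pi : R) (phase (z x)) => q b q0 w0.
field.
by rewrite w0 q0.
Qed.

End any_version.

(** Conditional measures are determined at [theta = 0], so any version of them has
    the image of [mu] under [to_section] there. *)
Lemma conditional_section (kappa : R -> probability (Borel M) R) :
  completely_regular_space M -> conditional_measures mu X z kappa ->
  forall B : set (Borel M), measurable B -> kappa 0 B = nu B.
Proof.
move=> crM ck B mB.
rewrite (conditional_unique scM crM (measurable_msupport mu) mz ck phase_conditional mB).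
rewrite phase_measureE; congr (nu _); apply/seteqP; split=> y /=; by rewrite mul0r Phi0.
Qed.

End existence.

(** * Continuous eigenfunctions *)

Section continuous_eigenfunction.
Context {R : realType} {M : ptopologicalType}.
Hypothesis hausM : hausdorff_space M.
Variable Phi : R -> M -> M.
Hypothesis Phi0 : forall x, Phi 0 x = x.
Hypothesis PhiD : forall s t x, Phi (s + t) x = Phi s (Phi t x).
Hypothesis PhiC : continuous (fun p : R * M => Phi p.1 p.2).
Variable X : set M.
Hypothesis X_compact : compact X.
Hypothesis Xinv : forall t x, X x -> X (Phi t x).
Variables (z : M -> Cx R) (omega : R).
Hypothesis omega0 : omega != 0.
Hypothesis cz : {within X, continuous z}.
Hypothesis z1 : forall x, X x -> `|z x| = 1.
Hypothesis zrel : forall t x, X x -> z (Phi t x) = cis (omega * t) * z x.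

Local Notation T := (2 * pi / omega).
Let L1 : set M := X `&` [set x | z x = 1].
Let Psi (p : M * R) : M := Phi (p.2 * T) p.1.

Lemma closed_within_preimage (f : M -> Cx R) (F : set (Cx R)) :
  {within X, continuous f} -> closed F -> closed (X `&` f @^-1` F).
Proof.
move=> cf cF; have cX := compact_closed hausM X_compact.
have cP : closed (f @^-1` F : set (subspace X)).
  by have := (continuous_closedP _).1 cf _ cF.
by have [V cV VX] := (closed_subspaceP _ _).1 cP; rewrite setIC -VX; exact: closedI.
Qed.

Lemma section_compact : compact L1.
Proof.
apply: (subclosed_compact _ X_compact); last by move=> x [].
apply: (closed_within_preimage (F := [set 1]) cz).
by apply: accessible_closed_set1; apply: hausdorff_accessible; exact: norm_hausdorff.
Qed.

Lemma section_period (k : int) y : L1 y -> L1 (Phi (k%:~R * T) y).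
Proof.
move=> [Xy zy]; split; first exact: Xinv.
rewrite /= zrel// zy mulr1 (_ : omega * _ = 2 * pi * k%:~R) ?cis_2pi_int//.
by field.
Qed.

Lemma section_bij : set_bij L1 L1 (Phi T).
Proof.
split.
- by move=> y /(section_period 1); rewrite mul1r.
- by move=> x y _ _ /(congr1 (Phi (- T))); rewrite !(PhiK Phi0 PhiD).
- move=> y Yy; exists (Phi (- T) y); last exact: (PhiNK Phi0 PhiD).
  by have := section_period (-1) Yy; rewrite mulrN1z mulN1r.
Qed.

Lemma eigen_suspension y s : L1 y -> z (Psi (y, s)) = cis (2 * pi * s).
Proof.
move=> [Xy zy]; rewrite /Psi /= zrel// zy mulr1; congr cis.
by field.
Qed.

Lemma suspension_point x : X x -> exists y s,
  [/\ L1 y, 0 <= s < 1 & Psi (y, s) = x].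
Proof.
move=> Xx; exists (Phi (- (phase (z x) * T)) x), (phase (z x)).
split; [|exact: phase_itv|exact: (PhiNK Phi0 PhiD)].
split; first exact: Xinv.
rewrite /= zrel// -[X in _ * X](phaseP (z1 Xx)) -cisD -[RHS]cis0; congr cis.
by field.
Qed.

Lemma suspension_bij : set_bij (suspension_space L1) X Psi.
Proof.
split.
- by move=> [y s] [[Xy _] _]; exact: Xinv.
- move=> [y s] [y' s'] /set_mem[/= Ly]; rewrite in_itv/= => sI.
  move=> /set_mem[/= Ly']; rewrite in_itv/= => sI' e.
  have ss : s = s'.
    apply: (cis_2pi_inj sI sI').
    by rewrite -(eigen_suspension s Ly) -(eigen_suspension s' Ly') e.
  move: e => /(congr1 (Phi (- (s * T)))).
  by rewrite ss /Psi /= !(PhiK Phi0 PhiD) => ->.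
- move=> x /suspension_point[y [s [Ly sI <-]]].
  by exists (y, s) => //; split=> //=; rewrite in_itv.
Qed.

Let K : set (M * R) := L1 `*` `[0, 1]%classic.

(** [Psi] maps the compact [L1 * [0, 1]] continuously into a Hausdorff space. *)
Lemma closed_flow_box_image (F : set (M * R)) : closed F ->
  closed (Psi @` (K `&` F)).
Proof.
move=> cF; apply: compact_closed => //; apply: continuous_compact.
  apply: continuous_subspaceT => p.
  apply: (@continuous_comp _ _ _ (fun p : M * R => (p.2 * T, p.1))
      (fun p : R * M => Phi p.1 p.2)); last exact: PhiC.
  move=> W [[P Q] /= [Pt Qx] PQW].
  have := @mulrr_continuous R T p.2 P Pt => nP.
  exists (Q, [set s | P (s * T)]) => [//|q [/= q1 q2]].
  exact: PQW.
apply: compact_closedI => //.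
by apply: compact_setX; [exact: section_compact|exact: segment_compact].
Qed.

(** The complement in [X] of the image of an open set [O] is the image of the closed
    part of [L1 * [0, 1]] lying over the complement of [O].  The closed interval is
    essential: points [(y, 1)] represent [(R y, 0)]. *)
Lemma suspension_open_flow :
  suspension_open_map (Phi T) (Phi (- T)) L1 X Psi.
Proof.
move=> O [OL [W [oW OW]]].
have cW : closed (~` W) by exact: open_closedC.
exists (~` (Psi @` (K `&` ~` W))); split.
  by apply: closed_openC; exact: closed_flow_box_image.
have [_ Psi_inj _] := suspension_bij.
have projE (p : M * R) : suspension_space L1 p -> suspension_proj (Phi T) (Phi (- T)) p = p.
  move=> Lp; apply: Psi_inj; [| exact: mem_set|].
    apply: mem_set; apply: (suspension_proj_space Phi0 PhiD section_period).
    by case: Lp.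
  exact: (suspension_proj_flow Phi0 PhiD).
apply/seteqP; split=> [_ [p Op <-]|x [Xx nx]].
  have Lp := OL p Op; split; first by case: Lp => -[Xp _] _; exact: Xinv.
  move=> [q [[Lq _] nWq] e]; apply: nWq; apply/OW => //.
  rewrite (_ : suspension_proj _ _ q = p)//.
  apply: Psi_inj; [| exact: mem_set|].
    by apply: mem_set; exact: (suspension_proj_space Phi0 PhiD section_period).
  by rewrite -e; exact: (suspension_proj_flow Phi0 PhiD).
have [y [s [Ly /andP[s0 s1] yx]]] := suspension_point Xx.
have Lp : suspension_space L1 (y, s) by split=> //=; rewrite in_itv/= s0.
exists (y, s) => //; apply: contrapT => nO; apply: nx; exists (y, s) => //.
split; first by split=> //=; rewrite in_itv/= s0 ltW.
by move=> Wp; apply: nO; rewrite -(projE _ Lp); apply/OW.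
Qed.

Section extension.
Variables (zetat zeta : M -> Cx R) (omega' : R).
Hypothesis czetat : {within L1, continuous zetat}.
Hypothesis zetat_eigen :
  forall x, L1 x -> zetat (Phi T x) = cis (2 * pi * omega' / omega) * zetat x.
Hypothesis zetaE : forall y s, L1 y -> 0 <= s < 1 ->
  zeta (Psi (y, s)) = cis (2 * pi * omega' * s / omega) * zetat y.

Lemma extensionE y u : L1 y ->
  zeta (Phi (u * T) y) = cis (2 * pi * omega' / omega * u) * zetat y.
Proof.
move=> Ly; apply: (eigen_extension Phi0 PhiD) => [k|k s s01].
  by apply: zetat_eigen; exact: section_period.
have := zetaE (section_period k Ly) s01; rewrite /Psi /= => ->.
congr (cis _ * _); exact: mulrAC.
Qed.

Lemma extension_koopman t x : X x -> zeta (Phi t x) = cis (omega' * t) * zeta x.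
Proof.
move=> /suspension_point[y [s [Ly _ <-]]]; rewrite /Psi /= -PhiD.
have T0 : T != 0 by rewrite mulf_neq0 ?invr_eq0// mulf_neq0 ?gt_eqF ?pi_gt0.
have tK : t / T * T = t by exact: (divfK T0).
rewrite (_ : t + _ = (t / T + s) * T); last by rewrite (mulrDl (t / T)) tK.
rewrite !extensionE// mulrA -cisD; congr (cis _ * _).
have tT : t / T = t * omega / (2 * pi) by rewrite invf_div mulrA.
have pi0 : 2 * pi != 0 :> R by rewrite mulf_neq0 ?gt_eqF ?pi_gt0.
rewrite tT; move: pi0 omega0; move: (2 * pi : R) => q q0 w0.
field.
by rewrite w0 q0.
Qed.

(** On the compact [L1 * [0, 1]] the extension is a continuous function of [(y, s)],
    also at [s = 1]; preimages of closed sets are carried by [Psi] to closed sets. *)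
Lemma extension_continuous : {within X, continuous zeta}.
Proof.
apply/continuous_closedP => F cF; apply/closed_subspaceP.
pose h (p : M * R) : Cx R := cis (2 * pi * omega' / omega * p.2) * zetat p.1.
have ch : {within K, continuous h}.
  apply/subspace_continuousP => p [Lp _].
  have f1 : zetat q.1 @[q --> within K (nbhs p)] --> zetat p.1.
    have cp := (subspace_continuousP _ _).1 czetat p.1 Lp.
    move=> U /cp nU; have {}nU : nbhs p.1 [set y | L1 y -> U (zetat y)] := nU.
    have n1 : nbhs p (fst @^-1` [set y | L1 y -> U (zetat y)]).
      exact: (@cvg_fst _ _ (nbhs p.1) (nbhs p.2) _ _ nU).
    by apply: filterS n1 => q qU [Lq _]; exact: qU.
  have f2 : cis (2 * pi * omega' / omega * q.2) @[q --> within K (nbhs p)] -->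
      cis (2 * pi * omega' / omega * p.2).
    apply: cvg_within_filter.
    apply: (@continuous_comp _ _ _ (fun q : M * R => 2 * pi * omega' / omega * q.2)
      (fun a : R => cis a)); last exact: continuous_cis.
    apply: (@continuous_comp _ _ _ (@snd M R) (fun s : R => 2 * pi * omega' / omega * s)).
      exact: cvg_snd.
    exact: mulrl_continuous.
  exact: (cvgM f2 f1).
have cH : closed (h @^-1` F : set (subspace K)).
  by have := (continuous_closedP _).1 ch _ cF.
have [V cV VK] := (closed_subspaceP _ _).1 cH.
exists (Psi @` (K `&` V)); first exact: closed_flow_box_image.
apply/seteqP; split=> [_ [[[y s] [Kp Vp] <-] Xx]|x [Fx Xx]]; split=> //.
  have [hF _] : (h @^-1` F `&` K) (y, s) by rewrite -VK.
  by have [Ly _] := Kp; rewrite -[_ (Psi _)]/(F (zeta (Phi (s * T) y))) extensionE.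
have [y [s [Ly /andP[s0 s1] yx]]] := suspension_point Xx.
have Kp : K (y, s) by split=> //=; rewrite in_itv/= s0 ltW.
exists (y, s) => //; split => //.
suff : (h @^-1` F `&` K) (y, s) by rewrite -VK => -[].
split=> //.
rewrite -[_ (y, s)]/(F (cis (2 * pi * omega' / omega * s) * zetat y)).
rewrite -(extensionE s Ly).
by move: yx; rewrite /Psi /= => ->.
Qed.

Lemma extend_eigen_C : koopman_eigen_C X Phi omega' zeta /\
  (~ vanishes_on L1 zetat -> ~ vanishes_on X zeta).
Proof.
split; first by split; [exact: extension_continuous|exact: extension_koopman].
move=> + v0; apply => y Ly; have [Xy _] := Ly.
by have := extensionE 0 Ly; rewrite mul0r Phi0 mulr0 cis0 mul1r v0.
Qed.

End extension.

End continuous_eigenfunction.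

(** * The conjugacy theorem *)

Section borel_version.
Context {R : realType} {M : ptopologicalType}.
Variables (X : set M) (z : M -> Cx R).
Hypothesis closedX : closed X.
Hypothesis cz : {within X, continuous z}.

(** The values of [z] off [X] are arbitrary; those of [zero_off] make it Borel on [M]. *)
Definition zero_off : M -> Cx R := fun x =>
  (((fun x => complex.Re (z x)) \_ X) x +i* ((fun x => complex.Im (z x)) \_ X) x)%C.

Lemma zero_offE x : X x -> zero_off x = z x.
Proof. by move=> Xx; rewrite /zero_off !patchE mem_set//; case: (z x). Qed.

Lemma zero_off_measurable : cmeasurable zero_off.
Proof.
split; apply: measurable_within => // x.
- by apply: continuous_comp; [exact: cz|exact: continuous_Re].
- by apply: continuous_comp; [exact: cz|exact: continuous_Im].
Qed.

Lemma zero_off_fiber theta : fiber X zero_off theta = fiber X z theta.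
Proof.
by apply/seteqP; split=> x [Xx]; rewrite /= => zx; split=> //=; rewrite ?zero_offE// -zero_offE.
Qed.

Lemma zero_off_conditional (mu : probability (Borel M) R) kappa :
  conditional_measures mu X z kappa <-> conditional_measures mu X zero_off kappa.
Proof.
by split=> -[k1 k2 k3 k4]; split=> // theta; rewrite -(k1 theta) zero_off_fiber.
Qed.

End borel_version.

Lemma eigenfrequency_neq0 (R : realType) (M : ptopologicalType)
  (scM : @second_countable M) (Phi : R -> M -> M)
  (Phi0 : forall x, Phi 0 x = x)
  (PhiD : forall s t x, Phi (s + t) x = Phi s (Phi t x))
  (PhiC : continuous (fun p : R * M => Phi p.1 p.2))
  (mu : probability (Borel M) R)
  (mu_inv : flow_invariant mu Phi) (mu_erg : flow_ergodic mu Phi)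
  (z : M -> Cx R) (omega : R) :
  cmeasurable z -> {ae mu, forall x, `|z x| = 1} ->
  {ae mu, forall x, forall t, z (Phi t x) = cis (omega * t) * z x} ->
  ~ (exists c, {ae mu, forall x, z x = c}) -> omega != 0.
Proof.
move=> mz z1 zrel nc; apply/eqP => o0; apply: nc; rewrite o0 in zrel.
exact: (eigenfrequency0 scM Phi0 PhiD PhiC mu_inv mu_erg mz z1 zrel).
Qed.

Theorem theorem4 (R : realType) (n : nat) (M : ptopologicalType)
  (hausM : hausdorff_space M) (scM : @second_countable M)
  (A : @C1_atlas R n M)
  (V : chart_idx A -> M -> 'rV[R]_n) (Phi : R -> M -> M)
  (flowPhi : C1_flow A Phi) (vfV : vector_field V) (genV : generates V Phi)
  (mu : probability (Borel M) R)
  (mu_inv : flow_invariant mu Phi) (mu_erg : flow_ergodic mu Phi)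
  (X_compact : compact (msupport mu))
  (z : M -> Cx R) (omega : R) :
  let X := msupport mu in
  let T := 2 * pi / omega in
  let Rmap := Phi T in
  let Gamma := suspension_flow Rmap (Phi (- T)) in
  let Psi := fun p : M * R => Phi (p.2 * T) p.1 in
  let eigval := fun omega' : R => cis (2 * pi * omega' / omega) in
  (* z in C(X) *)
  (koopman_eigen_C X Phi omega z ->
   (forall x, X x -> `|z x| = 1) ->
   ~ (exists c, forall x, X x -> z x = c) ->
   (exists kappa, conditional_measures mu X z kappa) /\
   forall kappa, conditional_measures mu X z kappa ->
   let L1 := fiber X z 0 in
   let nu := kappa 0 in
   (* (i) *)
   [/\ set_bij L1 L1 Rmap,
       set_bij (suspension_space L1) X Psi,
       forall t p, suspension_space L1 p ->
         Psi (Gamma t p) = Phi (2 * pi * t / omega) (Psi p),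
       suspension_continuous Rmap (Phi (- T)) L1 Psi /\
       suspension_open_map Rmap (Phi (- T)) L1 X Psi &
       forall B : set (Borel M), measurable B ->
         (nu \x lebesgue_measure)%E (suspension_space L1 `&` Psi @^-1` B)
         = mu B]
   /\
   (* (ii) *)
   (forall (zeta : M -> Cx R) (omega' : R),
      koopman_eigen_C X Phi omega' zeta ->
      let zetat := fun x => zeta (Psi (x, 0)) in
      map_eigen_C L1 Rmap (eigval omega') zetat /\
      (~ vanishes_on X zeta -> ~ vanishes_on L1 zetat))
   /\
   (forall (zeta : M -> Cx R) (omega' : R),
      koopman_eigen_L2 mu Phi omega' zeta ->
      (exists zeta1, orbitwise_version mu Phi omega' zeta zeta1) /\
      forall zeta1, orbitwise_version mu Phi omega' zeta zeta1 ->
      let zetat := fun x => zeta1 (Psi (x, 0)) in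
      map_eigen_L2 nu Rmap (eigval omega') zetat /\
      (~ vanishes_ae mu zeta -> ~ vanishes_ae nu zetat))
   /\
   (* (iii) *)
   (forall (zetat : M -> Cx R) (omega' : R),
      map_eigen_C L1 Rmap (eigval omega') zetat ->
      forall zeta : M -> Cx R,
      (forall y s, L1 y -> 0 <= s < 1 ->
         zeta (Psi (y, s)) = cis (2 * pi * omega' * s / omega) * zetat y) ->
      koopman_eigen_C X Phi omega' zeta /\
      (~ vanishes_on L1 zetat -> ~ vanishes_on X zeta))
   /\
   (forall (zetat : M -> Cx R) (omega' : R),
      map_eigen_L2 nu Rmap (eigval omega') zetat ->
      forall zeta : M -> Cx R,
      {ae nu, forall y, forall s, 0 <= s < 1 ->
         zeta (Psi (y, s)) = cis (2 * pi * omega' * s / omega) * zetat y} ->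
      koopman_eigen_L2 mu Phi omega' zeta /\
      (~ vanishes_ae nu zetat -> ~ vanishes_ae mu zeta)))
  /\
  (* z in L^2(mu) *)
  (koopman_eigen_L2 mu Phi omega z ->
   {ae mu, forall x, `|z x| = 1} ->
   ~ (exists c, {ae mu, forall x, z x = c}) ->
   (exists z1, orbitwise_version mu Phi omega z z1) /\
   forall z1, orbitwise_version mu Phi omega z z1 ->
   (exists kappa, conditional_measures mu X z1 kappa) /\
   forall kappa, conditional_measures mu X z1 kappa ->
   let L1 := fiber X z1 0 in
   let nu := kappa 0 in
   (* (i) *)
   ((exists Y : set (Borel M),
       [/\ [/\ measurable Y, Y `<=` L1 & nu Y = 1%E],
           set_bij Y Y Rmap,
           [/\ {in suspension_space Y &, injective Psi},
               Psi @` suspension_space Y `<=` X,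
               mu (Psi @` suspension_space Y) = 1%E &
               forall B : set (Borel M * R), measurable B ->
                 B `<=` suspension_space Y ->
                 measurable (Psi @` B : set (Borel M))],
           forall t p, suspension_space Y p ->
             Psi (Gamma t p) = Phi (2 * pi * t / omega) (Psi p) &
           suspension_continuous Rmap (Phi (- T)) Y Psi])
    /\
    forall B : set (Borel M), measurable B ->
      (nu \x lebesgue_measure)%E (suspension_space L1 `&` Psi @^-1` B) = mu B)
   /\
   (* (ii) *)
   (forall (zeta : M -> Cx R) (omega' : R),
      koopman_eigen_C X Phi omega' zeta ->
      let zetat := fun x => zeta (Psi (x, 0)) in
      map_eigen_C L1 Rmap (eigval omega') zetat /\
      (~ vanishes_on X zeta -> ~ vanishes_on L1 zetat))
   /\
   (forall (zeta : M -> Cx R) (omega' : R),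
      koopman_eigen_L2 mu Phi omega' zeta ->
      (exists zeta1, orbitwise_version mu Phi omega' zeta zeta1) /\
      forall zeta1, orbitwise_version mu Phi omega' zeta zeta1 ->
      let zetat := fun x => zeta1 (Psi (x, 0)) in
      map_eigen_L2 nu Rmap (eigval omega') zetat /\
      (~ vanishes_ae mu zeta -> ~ vanishes_ae nu zetat))
   /\
   (* (iii) *)
   (forall (zetat : M -> Cx R) (omega' : R),
      map_eigen_L2 nu Rmap (eigval omega') zetat ->
      forall zeta : M -> Cx R,
      {ae nu, forall y, forall s, 0 <= s < 1 ->
         zeta (Psi (y, s)) = cis (2 * pi * omega' * s / omega) * zetat y} ->
      koopman_eigen_L2 mu Phi omega' zeta /\
      (~ vanishes_ae nu zetat -> ~ vanishes_ae mu zeta))).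
Proof.
move=> X T Rmap Gamma Psi eigval.
have [Phi0 PhiD PhiC _] := flowPhi.
have crM : completely_regular_space M.
  exact: locally_compact_completely_regular (atlas_locally_compact A hausM) hausM.
have mX : measurable (X : set (Borel M)) := measurable_msupport mu.
have muX : mu X = 1%E by exact: msupport_full.
have aeX : {ae mu, forall x, X x} by exact: full_ae.
have Xinv t x : X x -> X (Phi t x) by exact: msupport_invariant.
have orbitwise zeta omega' : koopman_eigen_L2 mu Phi omega' zeta ->
    exists zeta1, orbitwise_version mu Phi omega' zeta zeta1.
  exact: orbitwise_version_exists.
split.
- move=> [cz zrel] z1 nconst.
  have closedX : closed X by exact: closed_msupport.
  pose z' := zero_off X z.
  have zE x : X x -> z' x = z x by exact: zero_offE.
  have mz' : cmeasurable z' by exact: zero_off_measurable.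
  have good x : X x -> [/\ X x, `|z' x| = 1 &
      forall t, z' (Phi t x) = cis (omega * t) * z' x].
    move=> Xx; split=> // [|t]; first by rewrite zE// z1.
    by rewrite !zE//; [exact: zrel|exact: Xinv].
  have om0 : omega != 0.
    apply: (eigenfrequency_neq0 scM Phi0 PhiD PhiC mu_inv mu_erg mz').
    - by apply: ae_sub aeX => x /good[].
    - by apply: ae_sub aeX => x /good[].
    - move=> [c zc]; apply: nconst; exists c; apply: (support_cst scM cz).
      by apply: ae_sub zc => x z'x Xx; rewrite -zE.
  have kE := zero_off_conditional X z mu.
  split.
    exists (phase_measure scM PhiC mu omega mz'); apply/kE.
    exact: (phase_conditional scM Phi0 PhiD PhiC mu_inv X_compact om0 mz' mX good Xinv muX).
  move=> kappa /kE ck L1 nu.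
  have nuE := conditional_section scM Phi0 PhiD PhiC mu_inv X_compact om0 mz' mX good Xinv muX crM ck.
  have LE : fiber X z' 0 = L1 by exact: zero_off_fiber.
  have L1E : L1 = X `&` [set x | z x = 1] by rewrite /L1 /fiber cis0.
  split; [split|split; [|split; [|split]]].
  + by rewrite L1E; exact: (section_bij Phi0 PhiD Xinv om0 zrel).
  + by rewrite L1E; exact: (suspension_bij Phi0 PhiD Xinv om0 z1 zrel).
  + move=> t p _; rewrite /Psi /Gamma.
    transitivity (Phi (t * T) (Psi p)); first exact: (suspension_flow_conj Phi0 PhiD).
    by congr Phi; rewrite mulrA; congr (_ / _); rewrite mulrC.
  + rewrite L1E; split.
      apply: (suspension_continuous_flow Phi0 PhiD PhiC).
      exact: (section_period Xinv om0 zrel).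
    exact: (suspension_open_flow hausM Phi0 PhiD PhiC X_compact Xinv om0 cz z1 zrel).
  + move=> B mB; rewrite -LE.
    exact: (product_formula Phi0 PhiD mu_inv om0 mX good Xinv muX nuE).
  + rewrite -LE => zeta omega' eig.
    exact: (restrict_eigen_C scM Phi0 PhiD om0 mX good Xinv muX).
  + move=> zeta omega' eig; split=> [|zeta1 v1]; first exact: orbitwise.
    exact: (restrict_eigen_L2 Phi0 PhiD mu_inv nuE eig v1).
  + move=> zetat omega'; rewrite L1E => -[czt ezt] zeta ztE.
    exact: (extend_eigen_C hausM Phi0 PhiD PhiC X_compact Xinv om0 cz z1 zrel czt ezt ztE).
  + move=> zetat omega' ezt zeta ztE.
    exact: (extend_eigen_L2 Phi0 PhiD mu_inv om0 mX good Xinv muX nuE ezt ztE).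
- move=> zL2 z1ae nconst; split; first exact: orbitwise.
  move=> z1 [mz1 z1z z1rel].
  have n1 : {ae mu, forall x, `|z1 x| = 1} by apply: ae_sub2 z1z z1ae => x ->.
  have om0 : omega != 0.
    apply: (eigenfrequency_neq0 scM Phi0 PhiD PhiC mu_inv mu_erg mz1 n1 z1rel).
    move=> [c zc]; apply: nconst; exists c.
    by apply: ae_sub2 z1z zc => x <-.
  have [G [mG good Ginv G1]] := good_set_exists scM Phi0 PhiD PhiC mu_inv n1 z1rel.
  split.
    exists (phase_measure scM PhiC mu omega mz1).
    exact: (phase_conditional scM Phi0 PhiD PhiC mu_inv X_compact om0 mz1 mG good Ginv G1).
  move=> kappa ck L1 nu.
  have nuE := conditional_section scM Phi0 PhiD PhiC mu_inv X_compact om0 mz1 mG good Ginv G1 crM ck.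
  split; [split|split; [|split]].
  + exact: (suspension_essential Phi0 PhiD om0 mG good Ginv G1 nuE).
  + move=> B mB.
    exact: (product_formula Phi0 PhiD mu_inv om0 mG good Ginv G1 nuE).
  + move=> zeta omega' eig.
    exact: (restrict_eigen_C scM Phi0 PhiD om0 mG good Ginv G1).
  + move=> zeta omega' eig; split=> [|zeta1 v1]; first exact: orbitwise.
    exact: (restrict_eigen_L2 Phi0 PhiD mu_inv nuE eig v1).
  + move=> zetat omega' ezt zeta ztE.
    exact: (extend_eigen_L2 Phi0 PhiD mu_inv om0 mG good Ginv G1 nuE ezt ztE).
Qed.
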